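(* Let $d$ be a positive integer and $\nu\in\mathbb{Q}$. The natural map $$\Psi:\ \mathrm{Max}^d_{S_\nu}\longrightarrow \mathrm{Free}^d_{S_{\nu,\pi}}\times \mathrm{Free}^d_{S_{\nu,u}},\qquad \mathcal{M}\mapsto(\mathcal{M}_\pi,\mathcal{M}_u)$$ is injective, and its image consists of the pairs $(A,B)$ such that $A$ and $B$ generate the same $\mathcal{E}$-vector space in $\mathcal{E}^d$. If a pair $(A,B)$ satisfies this condition, its unique preimage under $\Psi$ is given by $A\cap B$.
   Context: $R$ is a complete discrete valuation ring with uniformizer $\pi$ and fraction field $K$; $v_K$ is the valuation on $K$ normalized by $v_K(\pi)=1$. Write $\nu=\beta/\alpha$ with $\alpha\ge 1$ and $\alpha,\beta$ coprime integers. Define: - $S_\nu=\{\sum_{i\ge 0}a_iu^i\in K[[u]] : v_K(a_i)+\nu i\ge 0\ \forall i\}$; - $S_{\nu,\pi}=S_\nu[1/\pi]=\{\sum_{i\ge0}a_iu^i : a_i\in K,\ v_K(a_i)+\nu i \text{ bounded below}\}$; - $S_{\nu,u}$, the completion of $S_\nu[\pi^\beta/u^\alpha]$ for the Gauss valuation $v_\nu(\sum a_iu^i)=\min_i(v_K(a_i)+\nu i)$, i.e. $S_{\nu,u}=\{\sum_{i\in\mathbb{Z}}a_iu^i: a_i\in K,\ v_K(a_i)+\nu i\ge0,\ \lim_{i\to-\infty}(v_K(a_i)+\nu i)=+\infty\}$; - $\mathcal{E}=\{\sum_{i\in\mathbb{Z}}a_iu^i: a_i\in K,\ v_K(a_i)+\nu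 i\text{ bounded below},\ \lim_{i\to-\infty}(v_K(a_i)+\nu i)=+\infty\}$, a field containing all the rings above. A morphism of finitely generated $S_\nu$-modules is a quasi-isomorphism if its kernel and cokernel have finite length. A finitely generated torsion-free $S_\nu$-module $\mathcal{M}'$ together with a quasi-isomorphism $f:\mathcal{M}\to\mathcal{M}'$ from a finitely generated torsion-free module $\mathcal{M}$ is maximal for $\mathcal{M}$ if for every finitely generated torsion-free $\mathcal{N}$ and every quasi-isomorphism $f':\mathcal{M}\to\mathcal{N}$ there is a morphism $g:\mathcal{N}\to\mathcal{M}'$ with $g\circ f'=f$. A submodule $\mathcal{M}\subset S_\nu^d$ is called maximal if $(\mathcal{M},\mathrm{id})$ is maximal for $\mathcal{M}$. $\mathrm{Max}^d_{S_\nu}$ is the set of maximal sub-$S_\nu$-modules of $S_\nu^d$. For $A=S_{\nu,\pi}$ or $S_{\nu,u}$, $\mathrm{Free}^d_A$ is the set of sub-$A$-modules of $A^d$ that are free over $A$. For an $S_\nu$-submodule $\mathcal{M}$ of $\mathcal{E}^d$, $\mathcal{M}_\pi$ (resp. $\mathcal{M}_u$) is the sub-$S_{\nu,\pi}$-module (resp. sub-$S_{\nu,u}$-module) of $\mathcal{E}^d$ generated by $\mathcal{M}$. *)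

(* Defs.v *)
From HB Require Import structures.
From mathcomp Require Import all_boot all_order all_algebra all_classical.
From mathcomp Require Import zify ring.

Set Implicit Arguments.
Unset Strict Implicit.
Unset Printing Implicit Defensive.

Import Order.TTheory GRing.Theory Num.Theory.
Local Open Scope classical_set_scope.
Local Open Scope ring_scope.
Local Open Scope quotient_scope.

Local Notation "x %:F" := (tofrac x).

(* [v] is only meaningful on nonzero elements: the value [v 0] (morally +oo) is
   never used. *)
Record complete_dvr (R : idomainType) (pi : R) (v : {fraction R} -> int) :
    Prop := CompleteDVR {
  uniformizer_neq0 : pi != 0;
  valuation_uniformizer : v pi%:F = 1;
  valuationM : forall x y, x != 0 -> y != 0 -> v (x * y) = v x + v y;
  valuationD : forall x y, x != 0 -> y != 0 -> x + y != 0 ->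
    Num.min (v x) (v y) <= v (x + y);
  valuation_ring : forall x, x != 0 -> (0 <= v x <-> exists r : R, x = r%:F);
  adically_complete : forall s : nat -> R,
    (forall n, exists r, s n.+1 - s n = r * pi ^+ n) ->
    exists l, forall n, exists r, l - s n = r * pi ^+ n }.

Section Sums.
Context (R : idomainType) (v : {fraction R} -> int).
Local Notation K := {fraction R}.

Definition val_ge (x : K) (C : rat) : bool := (x == 0) || (C <= (v x)%:~R).

(* Convergence along the directed set of finite subsets of I. *)
Definition has_sum (I : choiceType) (x : I -> K) (s : K) : Prop :=
  forall C : rat, exists r0 : seq I, forall r : seq I,
    uniq r -> {subset r0 <= r} -> val_ge (s - \sum_(i <- r) x i) C.

Definition usum (I : choiceType) (x : I -> K) : K := xget 0 [set s | has_sum x s].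

Definition null_family (I : choiceType) (x : I -> K) : Prop :=
  forall C : rat, exists r0 : seq I, forall i, i \notin r0 -> val_ge (x i) C.

Context (pi : R) (D : complete_dvr pi v).

Lemma val_ge0 C : val_ge 0 C. Proof. by rewrite /val_ge eqxx. Qed.

Lemma val_geW x C C' : C' <= C -> val_ge x C -> val_ge x C'.
Proof. by rewrite /val_ge => CC /orP[->//|H]; rewrite (le_trans CC) ?orbT. Qed.

Lemma val_geD x y C : val_ge x C -> val_ge y C -> val_ge (x + y) C.
Proof.
rewrite /val_ge.
have [->|x0] := eqVneq x 0; first by rewrite add0r.
have [->|y0] := eqVneq y 0; first by rewrite addr0 (negPf x0).
have [//|xy0] := eqVneq (x + y) 0 => /= Hx Hy.
have := valuationD D x0 y0 xy0; rewrite -(ler_int rat); apply: le_trans.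
by case: (leP (v x) (v y)).
Qed.

Lemma v1 : v 1 = 0.
Proof.
have := valuationM D (oner_neq0 _) (oner_neq0 _); rewrite mulr1 => /eqP.
by rewrite -subr_eq0 opprD addNKr oppr_eq0 => /eqP.
Qed.

Lemma vN1 : v (-1) = 0.
Proof.
have N0 : (-1 : K) != 0 by rewrite oppr_eq0 oner_neq0.
have := valuationM D N0 N0; rewrite mulrNN mulr1 v1 => /esym/eqP.
by rewrite -mulr2n mulrn_eq0 => /eqP.
Qed.

Lemma val_geM x y C C' : val_ge x C -> val_ge y C' -> val_ge (x * y) (C + C').
Proof.
rewrite /val_ge.
have [->|x0] := eqVneq x 0; first by rewrite mul0r eqxx.
have [->|y0] := eqVneq y 0; first by rewrite mulr0 eqxx.
by rewrite mulf_eq0 (negPf x0) (negPf y0) /= (valuationM D) // intrD => *; apply: lerD.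
Qed.

Lemma val_ge1 : val_ge 1 0.
Proof. by rewrite /val_ge v1 lexx orbT. Qed.

Lemma val_geN x C : val_ge x C -> val_ge (- x) C.
Proof.
move=> xC; rewrite -mulN1r -[C]add0r; apply: val_geM => //.
by rewrite /val_ge vN1 lexx orbT.
Qed.

Lemma val_geB x y C : val_ge x C -> val_ge y C -> val_ge (x - y) C.
Proof. by move=> ? ?; apply/val_geD/val_geN. Qed.

Lemma val_ge_sum (I : Type) (r : seq I) (P : pred I) (F : I -> K) C :
  (forall i, P i -> val_ge (F i) C) -> val_ge (\sum_(i <- r | P i) F i) C.
Proof.
by move=> FC; apply: (big_ind (val_ge^~ C)) => //; [exact: val_ge0|move=> ? ?; exact: val_geD].
Qed.

Lemma val_ge_eq0 x : (forall C, val_ge x C) -> x = 0.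
Proof.
move=> /(_ ((v x + 1)%:~R)); rewrite /val_ge => /orP[/eqP//|].
by rewrite ler_int gerDl.
Qed.

Lemma val_ge_has (x : K) : exists C, val_ge x C.
Proof. by exists (v x)%:~R; rewrite /val_ge lexx orbT. Qed.

Lemma val_ge_nat (x : K) : (forall n : nat, val_ge x n%:R) -> forall C, val_ge x C.
Proof.
move=> xn C; apply: val_geW (xn (Num.truncn (Num.max 0 C)).+1).
apply/ltW; apply: le_lt_trans (truncnS_gt _); by rewrite le_max lexx orbT.
Qed.

Lemma nat_ge (C : rat) : exists n : nat, C <= n%:R.
Proof.
exists (Num.truncn (Num.max 0 C)).+1; apply/ltW.
by apply: le_lt_trans (truncnS_gt _); rewrite le_max lexx orbT.
Qed.

Lemma vX n : v (pi%:F ^+ n) = n%:Z.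
Proof.
have p0 : pi%:F != 0 by rewrite tofrac_eq0 (uniformizer_neq0 D).
elim: n => [|n IH]; first by rewrite expr0 v1.
by rewrite exprS (valuationM D) ?expf_neq0 // IH (valuation_uniformizer D) intS.
Qed.

Lemma val_ge_pow (x : R) (n : nat) : val_ge x%:F n%:R <-> exists r, x = r * pi ^+ n.
Proof.
have p0 : pi%:F ^+ n != 0 by rewrite expf_neq0 // tofrac_eq0 (uniformizer_neq0 D).
split=> [|[r ->]]; last first.
  rewrite tofracM tofracXn -[n%:R]add0r; apply: val_geM.
    have [->|r0] := eqVneq r%:F 0; first exact: val_ge0.
    by rewrite /val_ge ler0z (valuation_ring D r0).2 ?orbT; last by exists r.
  by rewrite /val_ge vX lexx orbT.
rewrite /val_ge => /orP[|xn].
  by rewrite tofrac_eq0 => /eqP ->; exists 0; rewrite mul0r.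
have [->|x0] := eqVneq x 0; first by exists 0; rewrite mul0r.
have fx0 : x%:F != 0 by rewrite tofrac_eq0.
have q0 : x%:F / pi%:F ^+ n != 0 by rewrite mulf_neq0 ?invr_eq0.
have /(valuation_ring D q0)[r rE] : 0 <= v (x%:F / pi%:F ^+ n).
  have := valuationM D q0 p0; rewrite divfK // vX => vx.
  by move: xn; rewrite vx (ler_int _ n%:Z) lerDr.
exists r; apply/eqP; rewrite -tofrac_eq; apply/eqP.
by rewrite tofracM tofracXn -rE divfK.
Qed.

Lemma val_ge_ring (x : K) : val_ge x 0 -> exists r : R, x = r%:F.
Proof.
have [->|x0] := eqVneq x 0; first by exists 0; rewrite tofrac0.
by rewrite /val_ge (negPf x0) ler0z => /(valuation_ring D x0).
Qed.

Lemma complete_frac (s : nat -> K) :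
  (forall n, val_ge (s n.+1 - s n) n%:R) -> exists l, forall n, val_ge (l - s n) n%:R.
Proof.
move=> sC.
have s0 n : val_ge (s n - s 0%N) 0.
  elim: n => [|n IH]; first by rewrite subrr val_ge0.
  rewrite -[s n.+1](subrK (s n)) -addrA; apply: val_geD => //.
  by apply: val_geW (sC n); rewrite ler0n.
have [t tE] := choice (fun n => val_ge_ring (s0 n)).
have [n|l lE] := adically_complete D (s := t).
  by apply/val_ge_pow; rewrite tofracB -!tE opprB addrA addrNK.
exists (l%:F + s 0%N) => n.
rewrite -addrA -[s 0%N - s n]opprB tE -tofracB.
exact/val_ge_pow.
Qed.

Section Theory.
Context (I : choiceType).
Implicit Types (x y : I -> K) (r c : seq I).

Lemma sum_sub x r c : uniq r -> uniq c -> {subset c <= r} ->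
  \sum_(i <- r) x i - \sum_(i <- c) x i = \sum_(i <- r | i \notin c) x i.
Proof.
move=> ur uc cr; rewrite (bigID (mem c)) /= addrAC.
rewrite -big_filter (perm_big c) /= ?subrr ?add0r //.
apply: uniq_perm => //; first exact: filter_uniq.
by move=> i; rewrite mem_filter; apply/andb_idr/cr.
Qed.

Lemma has_sum_unique x s t : has_sum x s -> has_sum x t -> s = t.
Proof.
move=> xs xt; apply/subr0_eq/val_ge_eq0 => C.
have [r1 H1] := xs C; have [r2 H2] := xt C.
have u := undup_uniq (r1 ++ r2).
have := val_geB (H1 _ u _) (H2 _ u _).
rewrite opprB addrA subrK; apply=> i ir; by rewrite mem_undup mem_cat ir ?orbT.
Qed.

Lemma usumE x s : has_sum x s -> usum x = s.
Proof. by move=> xs; apply: xget_unique => // t /has_sum_unique; apply. Qed.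

Lemma has_sum_tail x s C r0 : has_sum x s ->
  (forall i, i \notin r0 -> val_ge (x i) C) ->
  forall r, uniq r -> {subset r0 <= r} -> val_ge (s - \sum_(i <- r) x i) C.
Proof.
move=> xs x0 r ur r0r; have [r1 H1] := xs C.
have u := undup_uniq (r ++ r1).
have r' : {subset r <= undup (r ++ r1)} by move=> i; rewrite mem_undup mem_cat => ->.
rewrite -(subrK (\sum_(i <- undup (r ++ r1)) x i) s) -addrA; apply: val_geD.
  by apply: H1 => // i; rewrite mem_undup mem_cat orbC => ->.
rewrite sum_sub //; apply: val_ge_sum => i ir; apply: x0.
by apply: contra ir; apply: r0r.
Qed.

Lemma null_has_sum x : null_family x -> exists s, has_sum x s.
Proof.
move=> x0; have [r rE] := choice (fun n : nat => x0 n%:R).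
pose c := fix c (n : nat) := if n is m.+1 then undup (c m ++ r n) else undup (r 0%N).
have uc n : uniq (c n) by case: n => [|n]; exact: undup_uniq.
have cS n : {subset c n <= c n.+1} by move=> i; rewrite mem_undup mem_cat => ->.
have rc n : {subset r n <= c n}.
  by case: n => [|n] i; rewrite mem_undup // mem_cat => ->; rewrite orbT.
have [|s sE] := @complete_frac (fun n => \sum_(i <- c n) x i).
  move=> n; rewrite sum_sub //; apply: val_ge_sum => i ic; apply: rE.
  by apply: contra ic; apply: rc.
exists s => C; have [n Cn] := nat_ge C.
exists (c n) => r' ur' cr'; apply: val_geW Cn _.
rewrite -(subrK (\sum_(i <- c n) x i) s) -addrA; apply: val_geD => //.
rewrite -opprB; apply: val_geN; rewrite sum_sub //; apply: val_ge_sum => i ic.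
by apply: rE; apply: contra ic; apply: rc.
Qed.

Lemma usumP x : null_family x -> has_sum x (usum x).
Proof. by move=> /null_has_sum[s xs]; rewrite (usumE xs). Qed.

Lemma has_sumD x y s t : has_sum x s -> has_sum y t -> has_sum (fun i => x i + y i) (s + t).
Proof.
move=> xs yt C; have [r1 H1] := xs C; have [r2 H2] := yt C.
exists (r1 ++ r2) => r ur rr; rewrite big_split opprD addrACA; apply: val_geD.
  by apply: H1 => // i ir; apply: rr; rewrite mem_cat ir.
by apply: H2 => // i ir; apply: rr; rewrite mem_cat ir orbT.
Qed.

Lemma has_sumZ a x s : has_sum x s -> has_sum (fun i => a * x i) (a * s).
Proof.
move=> xs C; have [A aA] := val_ge_has a; have [r0 H] := xs (C - A).
exists r0 => r ur r0r; rewrite -mulr_sumr -mulrBr -[C](subrKC A).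
exact/val_geM/H.
Qed.

Lemma val_ge_has_sum x s C : has_sum x s -> (forall i, val_ge (x i) C) -> val_ge s C.
Proof.
move=> xs xC; rewrite -[s]subr0.
by have := @has_sum_tail x s C [::] xs (fun i _ => xC i) [::]; rewrite big_nil; apply.
Qed.

Lemma has_sum1 x i0 : (forall i, i != i0 -> x i = 0) -> has_sum x (x i0).
Proof.
move=> x0 C; exists [:: i0] => r ur r0.
rewrite (bigD1_seq i0) //= ?big1 ?addr0 ?subrr ?val_ge0 //.
by apply: r0; rewrite mem_head.
Qed.

End Theory.

Lemma has_sum_bij (I J : choiceType) (f : J -> I) (g : I -> J) (x : I -> K) s :
  cancel f g -> cancel g f -> has_sum x s -> has_sum (x \o f) s.
Proof.
move=> fK gK xs C; have [r0 H] := xs C; exists (map g r0) => r ur r0r.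
rewrite -(big_map f xpredT x); apply: H; first by rewrite map_inj_uniq //; exact: can_inj fK.
by move=> i ir; rewrite -[i]gK; apply/map_f/r0r/map_f.
Qed.

Lemma has_sum_pair (I J : choiceType) (x : I * J -> K) s : null_family x ->
  has_sum x s -> has_sum (fun i => usum (fun j => x (i, j))) s.
Proof.
move=> x0 xs C.
have [r0 H0] := x0 C.
have y0 i : null_family (fun j => x (i, j)).
  move=> C'; have [r1 H1] := x0 C'; exists (map snd r1) => j jr; apply: H1.
  by apply: contra jr => /(map_f snd).
exists (map fst r0) => r ur r0r.
pose J0 := undup (map snd r0).
have -> : s - \sum_(i <- r) usum (fun j => x (i, j)) =
   (s - \sum_(i <- r) \sum_(j <- J0) x (i, j)) -
   \sum_(i <- r) (usum (fun j => x (i, j)) - \sum_(j <- J0) x (i, j)).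
  by rewrite sumrB opprB addrA subrK.
apply: val_geB.
  rewrite -big_allpairs.
  apply: (has_sum_tail xs H0).
    by apply: allpairs_uniq => //; [exact: undup_uniq|move=> [? ?] [? ?]].
  move=> [i j] ij; apply/allpairsP; exists (i, j); split=> //=.
    by apply: r0r; apply: (map_f fst ij).
  by rewrite mem_undup; apply: (map_f snd ij).
apply: val_ge_sum => i _.
apply: (has_sum_tail (usumP (y0 i)) (r0 := J0)) => [j jJ||//]; last exact: undup_uniq.
by apply: H0; apply: contra jJ => /(map_f snd); rewrite mem_undup.
Qed.

Lemma usum_exchange (I J : choiceType) (x : I * J -> K) : null_family x ->
  usum (fun i => usum (fun j => x (i, j))) = usum (fun j => usum (fun i => x (i, j))).
Proof.
move=> x0; have xs := usumP x0; rewrite (usumE (has_sum_pair x0 xs)).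
pose sw (p : J * I) := (p.2, p.1).
have x0' : null_family (x \o sw).
  move=> C; have [r0 H0] := x0 C; exists (map (fun p => (p.2, p.1)) r0) => -[j i] ji.
  by apply: H0; apply: contra ji => ij; apply/mapP; exists (i, j).
apply/esym/usumE/(has_sum_pair x0').
by apply: (has_sum_bij (g := fun p : I * J => (p.2, p.1))) xs => -[].
Qed.

End Sums.

Section Laurent.
Context (R : idomainType) (pi : R) (v : {fraction R} -> int).
Context (D : complete_dvr pi v) (nu : rat).
Local Notation K := {fraction R}.
Implicit Types (a b c : int -> K) (i j n : int).

(* "v_K(a_i) + nu i >= C" *)
Definition gauss_ge a i (C : rat) : bool :=
  (a i == 0) || (C <= (v (a i))%:~R + nu * i%:~R).

Definition bounded_series a : Prop := exists C, forall i, gauss_ge a i C.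

Definition null_at_ninfty a : Prop :=
  forall C, exists N : int, forall i, i <= N -> gauss_ge a i C.

Definition is_laurent : {pred int -> K} :=
  fun a => `[< bounded_series a /\ null_at_ninfty a >].

Lemma gauss_geE a i C : gauss_ge a i C = val_ge v (a i) (C - nu * i%:~R).
Proof. by rewrite /gauss_ge /val_ge lerBlDr. Qed.

Lemma laurentP a : reflect (bounded_series a /\ null_at_ninfty a) (a \in is_laurent).
Proof. exact: asboolP. Qed.

Lemma is_laurent_zmod : zmod_closed is_laurent.
Proof.
split=> [|a b /laurentP[[A aA] a0] /laurentP[[B bB] b0]]; apply/laurentP; split.
- by exists 0 => i; rewrite /gauss_ge eqxx.
- by move=> C; exists 0 => i _; rewrite /gauss_ge eqxx.
- exists (Num.min A B) => i; rewrite gauss_geE; apply: (val_geB D).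
    by have := aA i; rewrite gauss_geE; apply: val_geW; rewrite lerD2r ge_min lexx.
  by have := bB i; rewrite gauss_geE; apply: val_geW; rewrite lerD2r ge_min lexx orbT.
- move=> C; have [N1 H1] := a0 C; have [N2 H2] := b0 C.
  exists (Num.min N1 N2) => i; rewrite le_min => /andP[/H1 i1 /H2 i2].
  by move: i1 i2; rewrite !gauss_geE; exact: (val_geB D).
Qed.

HB.instance Definition _ := GRing.isZmodClosed.Build _ is_laurent is_laurent_zmod.

Definition seq_box (L : nat) : seq int := [seq k%:Z - L%:Z | k <- iota 0 (2 * L).+1].

Arguments seq_box : simpl never.

Lemma mem_seq_box L i : (absz i <= L)%N -> i \in seq_box L.
Proof.
by move=> iL; apply/mapP; exists (absz (i + L%:Z)); [rewrite mem_iota|]; lia.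
Qed.

Lemma laurent_nat_null a : null_at_ninfty a -> forall C,
  exists N : nat, forall i, i <= - N%:Z -> gauss_ge a i C.
Proof. by move=> a0 C; have [N H] := a0 C; exists (absz N) => i iN; apply: H; lia. Qed.

Lemma triple_null a b c n : a \in is_laurent -> b \in is_laurent -> c \in is_laurent ->
  null_family v (fun p : int * int => a p.1 * b (p.2 - p.1) * c (n - p.2)).
Proof.
move=> /laurentP[[A aA] /laurent_nat_null a0] /laurentP[[B bB] /laurent_nat_null b0].
move=> /laurentP[[G cG] /laurent_nat_null c0] C.
have [N1 H1] := a0 (C + nu * n%:~R - B - G).
have [N2 H2] := b0 (C + nu * n%:~R - A - G).
have [N3 H3] := c0 (C + nu * n%:~R - A - B).
pose L := (2 * (N1 + N2 + N3) + absz n)%N.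
exists [seq (i, j) | i <- seq_box L, j <- seq_box L] => -[i j] ij.
change (val_ge v (a i * b (j - i) * c (n - j)) C).
have E x y z : gauss_ge a i x -> gauss_ge b (j - i) y -> gauss_ge c (n - j) z ->
    C = x + y + z - nu * n%:~R -> val_ge v (a i * b (j - i) * c (n - j)) C.
  rewrite !gauss_geE => ax bY cz CE.
  have -> : C = (x - nu * i%:~R) + (y - nu * (j - i)%:~R) + (z - nu * (n - j)%:~R).
    by rewrite CE !intrB; ring.
  by do !apply: (val_geM D).
have [iN|iN] := leP i (- N1%:Z); first by apply: E (H1 _ iN) (bB _) (cG _) _; ring.
have [jN|jN] := leP (j - i) (- N2%:Z); first by apply: E (aA _) (H2 _ jN) (cG _) _; ring.
have [kN|kN] := leP (n - j) (- N3%:Z); first by apply: E (aA _) (bB _) (H3 _ kN) _; ring.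
by case/negP: ij; apply: allpairs_f; apply: mem_seq_box; rewrite /L; lia.
Qed.

Lemma pair_null a b n : a \in is_laurent -> b \in is_laurent ->
  null_family v (fun i => a i * b (n - i)).
Proof.
move=> /laurentP[[A aA] /laurent_nat_null a0] /laurentP[[B bB] /laurent_nat_null b0] C.
have [N1 H1] := a0 (C + nu * n%:~R - B).
have [N2 H2] := b0 (C + nu * n%:~R - A).
exists (seq_box (N1 + N2 + absz n)) => i iL.
have E x y : gauss_ge a i x -> gauss_ge b (n - i) y ->
    C = x + y - nu * n%:~R -> val_ge v (a i * b (n - i)) C.
  rewrite !gauss_geE => ax bY CE.
  have -> : C = (x - nu * i%:~R) + (y - nu * (n - i)%:~R) by rewrite CE !intrB; ring.
  exact: (val_geM D).
have [iN|iN] := leP i (- N1%:Z); first by apply: E (H1 _ iN) (bB _) _; ring.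
have [jN|jN] := leP (n - i) (- N2%:Z); first by apply: E (aA _) (H2 _ jN) _; ring.
by case/negP: iL; apply: mem_seq_box; lia.
Qed.

(* The defining family tends to 0 by pair_null, so this sum over Z converges in K. *)
Definition series_mul a b : int -> K := fun n => usum v (fun i => a i * b (n - i)).

Definition series_one : int -> K := fun n => (n == 0)%:R.

Lemma series_mul_ge a b A B : a \in is_laurent -> b \in is_laurent ->
  (forall i, gauss_ge a i A) -> (forall i, gauss_ge b i B) ->
  forall i, gauss_ge (series_mul a b) i (A + B).
Proof.
move=> aE bE aA bB n; rewrite gauss_geE.
apply: (val_ge_has_sum D (usumP D (pair_null n aE bE))) => i.
have -> : A + B - nu * n%:~R = (A - nu * i%:~R) + (B - nu * (n - i)%:~R).
  by rewrite !intrB; ring.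
by apply: (val_geM D); rewrite -gauss_geE.
Qed.

Lemma series_mul_laurent a b : a \in is_laurent -> b \in is_laurent ->
  series_mul a b \in is_laurent.
Proof.
move=> aE bE; have /laurentP[[A aA] /laurent_nat_null a0] := aE.
have /laurentP[[B bB] /laurent_nat_null b0] := bE.
apply/laurentP; split; first by exists (A + B); exact: series_mul_ge.
move=> C; have [N1 H1] := a0 (C - B); have [N2 H2] := b0 (C - A).
exists (- (N1 + N2)%:Z) => n nN; rewrite gauss_geE.
apply: (val_ge_has_sum D (usumP D (pair_null n aE bE))) => i.
have E x y : gauss_ge a i x -> gauss_ge b (n - i) y -> C = x + y ->
    val_ge v (a i * b (n - i)) (C - nu * n%:~R).
  rewrite !gauss_geE => ax bY CE.
  have -> : C - nu * n%:~R = (x - nu * i%:~R) + (y - nu * (n - i)%:~R).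
    by rewrite CE !intrB; ring.
  exact: (val_geM D).
have [iN|iN] := leP i (- N1%:Z); first by apply: E (H1 _ iN) (bB _) _; ring.
by apply: E (aA _) (H2 _ _) _; [lia|ring].
Qed.

Lemma series_one_laurent : series_one \in is_laurent.
Proof.
apply/laurentP; split.
  exists 0 => i; rewrite /gauss_ge /series_one.
  have [->|] := eqVneq i 0; last by rewrite eqxx.
  by rewrite (v1 D) mulr0 addr0 lexx orbT.
move=> C; exists (-1) => i i1; rewrite /gauss_ge /series_one.
by have [i0|] := eqVneq i 0; [lia|rewrite eqxx].
Qed.

Lemma series_mulC a b : a \in is_laurent -> b \in is_laurent ->
  series_mul a b = series_mul b a.
Proof.
move=> aE bE; apply/funext => n; apply: (usumE D).
have := has_sum_bij (f := fun i => n - i) (g := fun i => n - i) _ _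
  (usumP D (pair_null n bE aE)).
have K i : n - (n - i) = i by lia.
move=> /(_ K K); rewrite /comp; congr (has_sum _ _ _).
by apply/funext => i; rewrite K mulrC.
Qed.

Lemma series_mul1 a : a \in is_laurent -> series_mul series_one a = a.
Proof.
move=> aE; apply/funext => n; apply: (usumE D).
have := @has_sum1 _ v int (fun i => series_one i * a (n - i)) 0.
rewrite /series_one eqxx mul1r subr0; apply => i /negPf ->; exact: mul0r.
Qed.

Lemma series_mulDl a b c : a \in is_laurent -> b \in is_laurent -> c \in is_laurent ->
  series_mul (a + b) c = series_mul a c + series_mul b c.
Proof.
move=> aE bE cE; apply/funext => n; apply: (usumE D).
have := has_sumD D (usumP D (pair_null n aE cE)) (usumP D (pair_null n bE cE)).
by congr (has_sum _ _ _); apply/funext => i; rewrite -mulrDl.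
Qed.

Lemma series_mulA a b c : a \in is_laurent -> b \in is_laurent -> c \in is_laurent ->
  series_mul a (series_mul b c) = series_mul (series_mul a b) c.
Proof.
move=> aE bE cE; apply/funext => n; rewrite {1 3}/series_mul.
pose x (p : int * int) := a p.1 * b (p.2 - p.1) * c (n - p.2).
transitivity (usum v (fun i => usum v (fun j => x (i, j)))).
  congr usum; apply/funext => i; apply/esym/(usumE D).
  have K1 : cancel (fun j => j - i) (fun j => j + i) by move=> j; lia.
  have K2 : cancel (fun j => j + i) (fun j => j - i) by move=> j; lia.
  have := has_sumZ D (a i) (has_sum_bij K1 K2 (usumP D (pair_null (n - i) bE cE))).
  congr (has_sum _ _ _); apply/funext => j; rewrite /x /= mulrA.
  by congr (_ * c _); lia.
rewrite (usum_exchange D (triple_null n aE bE cE)).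
congr usum; apply/funext => j; apply: (usumE D).
have := has_sumZ D (c (n - j)) (usumP D (pair_null j aE bE)).
rewrite [X in has_sum _ _ X]mulrC.
by congr (has_sum _ _ _); apply/funext => i; rewrite mulrC.
Qed.

End Laurent.

(* The argument D does not occur in the body: it is recorded in the type because
   the ring structure needs the axioms of a complete valuation. *)
Definition calE (R : idomainType) (pi : R) (v : {fraction R} -> int)
    (D : complete_dvr pi v) (nu : rat) : Type :=
  {a : int -> {fraction R} | a \in is_laurent v nu}.

Section CalE.
Context (R : idomainType) (pi : R) (v : {fraction R} -> int).
Context (D : complete_dvr pi v) (nu : rat).
Local Notation E := (calE D nu).

HB.instance Definition _ := [isSub of E for sval].
HB.instance Definition _ := [Choice of E by <:].
HB.instance Definition _ := GRing.SubChoice_isSubZmodule.Build _ _ E (is_laurent_zmod D nu).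

Definition coef (f : E) : int -> {fraction R} := val f.

Definition calE_mul (f g : E) : E :=
  Sub (series_mul v (coef f) (coef g)) (series_mul_laurent D (valP f) (valP g)).

Definition calE_one : E := Sub (series_one R) (series_one_laurent D nu).

Lemma calE_mulA : associative calE_mul.
Proof. by move=> f g h; apply/val_inj/(series_mulA D (valP f) (valP g) (valP h)). Qed.

Lemma calE_mulC : commutative calE_mul.
Proof. by move=> f g; apply/val_inj/(series_mulC D (valP f) (valP g)). Qed.

Lemma calE_mul1 : left_id calE_one calE_mul.
Proof. by move=> f; apply/val_inj/(series_mul1 D (valP f)). Qed.

Lemma calE_mulDl : left_distributive calE_mul +%R.
Proof. by move=> f g h; apply/val_inj/(series_mulDl D (valP f) (valP g) (valP h)). Qed.

Lemma calE_one_neq0 : calE_one != 0.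
Proof.
apply/eqP => /(congr1 (fun f => coef f 0)).
by rewrite /coef /= /series_one eqxx => /eqP; rewrite oner_eq0.
Qed.

HB.instance Definition _ := GRing.Zmodule_isComNzRing.Build E
  calE_mulA calE_mulC calE_mul1 calE_mulDl calE_one_neq0.

Lemma coef1 i : coef 1 i = (i == 0)%:R. Proof. by []. Qed.

Lemma coefB (f g : E) i : coef (f - g) i = coef f i - coef g i. Proof. by []. Qed.

Lemma coefM (f g : E) n : coef (f * g) n = usum v (fun i => coef f i * coef g (n - i)).
Proof. by []. Qed.

(* A power series with v_K(a_i) + nu i bounded below lies in E, so S_nu and
   S_(nu,pi) may be cut out of E rather than of K[[u]]; likewise the limit and
   boundedness conditions in S_(nu,u) and S_(nu,pi) are those of E itself. *)
Definition Snu_pred : {pred E} := fun f =>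
  `[< (forall i, i < 0 -> coef f i = 0) /\ (forall i, gauss_ge v nu (coef f) i 0) >].

Definition Spi_pred : {pred E} := fun f => `[< forall i, i < 0 -> coef f i = 0 >].

Definition Su_pred : {pred E} := fun f => `[< forall i, gauss_ge v nu (coef f) i 0 >].

Lemma Spi_subring : subring_closed Spi_pred.
Proof.
split=> [|f g /asboolP f0 /asboolP g0|f g /asboolP f0 /asboolP g0]; apply/asboolP => i i0.
- by rewrite coef1 lt_eqF.
- by rewrite coefB f0 // g0 // subrr.
rewrite coefM; apply: (usumE D).
suff -> : (fun j => coef f j * coef g (i - j)) = fun=> 0.
  by move=> C; exists [::] => r _ _; rewrite big1 // subrr val_ge0.
apply/funext => j; have [j0|j0] := ltP j 0; first by rewrite f0 ?mul0r.
by rewrite [coef g _]g0 ?mulr0 //; lia.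
Qed.

Lemma Su_subring : subring_closed Su_pred.
Proof.
split=> [|f g /asboolP f0 /asboolP g0|f g /asboolP f0 /asboolP g0]; apply/asboolP => i.
- rewrite /gauss_ge coef1; have [->|_] := eqVneq i 0; last by rewrite eqxx.
  by rewrite (v1 D) mulr0 addr0 lexx orbT.
- by have := f0 i; have := g0 i; rewrite !gauss_geE coefB => *; apply: (val_geB D).
by rewrite -[0]addr0; apply: (series_mul_ge D (valP f) (valP g)).
Qed.

Lemma SnuE f : (f \in Snu_pred) = (f \in Spi_pred) && (f \in Su_pred).
Proof. by apply/asboolP/andP => [[? ?]|[/asboolP ? /asboolP ?]]; split=> //; apply/asboolP. Qed.

Lemma Snu_subring : subring_closed Snu_pred.
Proof.
have [p1 pB pM] := Spi_subring; have [u1 uB uM] := Su_subring.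
split=> [|f g|f g]; rewrite !SnuE; first by rewrite p1 u1.
  by move=> /andP[? ?] /andP[? ?]; rewrite pB ?uB.
by move=> /andP[? ?] /andP[? ?]; rewrite pM ?uM.
Qed.

HB.instance Definition _ := GRing.isSubringClosed.Build E Snu_pred Snu_subring.
HB.instance Definition _ := GRing.isSubringClosed.Build E Spi_pred Spi_subring.
HB.instance Definition _ := GRing.isSubringClosed.Build E Su_pred Su_subring.

Definition Snu : subringClosed E := Snu_pred.
Definition Spi : subringClosed E := Spi_pred.
Definition Su : subringClosed E := Su_pred.

End CalE.

Section SubringType.
Context (E : comNzRingType) (S : subringClosed E).

Definition subring_type : Type := {x : E | x \in S}.

HB.instance Definition _ := [isSub of subring_type for sval].
HB.instance Definition _ := [Choice of subring_type by <:].
HB.instance Definition _ := [SubChoice_isSubComNzRing of subring_type by <:].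

End SubringType.

(* An alias of V that carries the S-module structure; the underlying type is V. *)
Definition restrict_scalars (E : comNzRingType) (S : subringClosed E) (V : lmodType E) :
  Type := V.

Section RestrictScalarsModule.
Context (E : comNzRingType) (S : subringClosed E) (V : lmodType E).

HB.instance Definition _ := GRing.Zmodule.copy (restrict_scalars S V) V.

Definition restrict_scale (a : subring_type S) (x : restrict_scalars S V) :
  restrict_scalars S V := val a *: (x : V).

Lemma restrict_scaleA a b x : restrict_scale a (restrict_scale b x) = restrict_scale (a * b) x.
Proof. exact: scalerA. Qed.

Lemma restrict_scale1 : left_id 1 restrict_scale.
Proof. by move=> x; exact: scale1r. Qed.

Lemma restrict_scaleDr : right_distributive restrict_scale +%R.
Proof. by move=> a x y; exact: scalerDr. Qed.

Lemma restrict_scaleDl x : {morph restrict_scale^~ x : a b / a + b}.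
Proof. by move=> a b; exact: scalerDl. Qed.

HB.instance Definition _ := GRing.Zmodule_isLmodule.Build (subring_type S) (restrict_scalars S V)
  restrict_scaleA restrict_scale1 restrict_scaleDr restrict_scaleDl.

End RestrictScalarsModule.

Section Submodules.
Context (S : comNzRingType) (V : lmodType S).

Definition is_submodule (M : set V) : Prop :=
  M 0 /\ forall a x y, M x -> M y -> M (a *: x + y).

Definition submodule_span (X : set V) : set V := smallest is_submodule X.

Definition linearly_independent (B : set V) : Prop :=
  forall n (b : 'I_n -> V) (c : 'I_n -> S), injective b -> (forall i, B (b i)) ->
  \sum_i c i *: b i = 0 -> forall i, c i = 0.

Definition is_free (M : set V) : Prop :=
  exists B : set V, linearly_independent B /\ submodule_span B = M.

Context (M : set V) (hM : is_submodule M).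

Definition submodule_pred of is_submodule M : {pred V} := fun x => `[< M x >].

Lemma submodule_pred_closed : submod_closed (submodule_pred hM).
Proof.
case: (hM) => M0 ML; split; first exact/asboolP.
by move=> a x y /asboolP Mx /asboolP My; apply/asboolP/ML.
Qed.

HB.instance Definition _ := GRing.isSubmodClosed.Build S V (submodule_pred hM)
  submodule_pred_closed.

Definition submodule_type : Type := {x : V | x \in submodule_pred hM}.

HB.instance Definition _ := [isSub of submodule_type for sval].
HB.instance Definition _ := [Choice of submodule_type by <:].
HB.instance Definition _ := [SubChoice_isSubLmodule of submodule_type by <:].

Definition quotient_module : Type := {ideal_quot submodule_pred hM}.

HB.instance Definition _ := GRing.Zmodule.on quotient_module.
HB.instance Definition _ := EqQuotient.on quotient_module.

Definition quotient_scale (a : S) (x : quotient_module) : quotient_module :=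
  \pi_quotient_module (a *: repr x).

Lemma quotient_scale_pi a x :
  quotient_scale a (\pi_quotient_module x) = \pi_quotient_module (a *: x).
Proof.
apply/eqP; rewrite -[_ == _]Quotient.idealrBE -scalerBr; apply: rpredZ.
by rewrite Quotient.idealrBE reprK.
Qed.

Lemma quotient_pi_repr x : \pi_quotient_module (repr x) = x.
Proof. exact: reprK. Qed.

Lemma quotient_piD x y :
  \pi_quotient_module (x + y) = \pi_quotient_module x + \pi_quotient_module y.
Proof. exact: raddfD. Qed.

Lemma quotient_scaleA a b x : quotient_scale a (quotient_scale b x) = quotient_scale (a * b) x.
Proof. by rewrite -[x]quotient_pi_repr !quotient_scale_pi scalerA. Qed.

Lemma quotient_scale1 : left_id 1 quotient_scale.
Proof. by move=> x; rewrite -[x]quotient_pi_repr quotient_scale_pi scale1r. Qed.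

Lemma quotient_scaleDr : right_distributive quotient_scale +%R.
Proof.
move=> a x y; rewrite -[x]quotient_pi_repr -[y]quotient_pi_repr -quotient_piD.
by rewrite !quotient_scale_pi scalerDr quotient_piD.
Qed.

Lemma quotient_scaleDl x : {morph quotient_scale^~ x : a b / a + b}.
Proof.
move=> a b; rewrite -[x]quotient_pi_repr.
by rewrite !quotient_scale_pi scalerDl quotient_piD.
Qed.

HB.instance Definition _ := GRing.Zmodule_isLmodule.Build S quotient_module
  quotient_scaleA quotient_scale1 quotient_scaleDr quotient_scaleDl.

End Submodules.

Section Maximal.
Context (S : comNzRingType).
Implicit Types V M N : lmodType S.

Definition finitely_generated V : Prop :=
  exists n (g : 'I_n -> V), forall x, exists c : 'I_n -> S, x = \sum_i c i *: g i.

Definition torsion_free V : Prop :=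
  forall (a : S) (x : V), a *: x = 0 -> a = 0 \/ x = 0.

Definition finite_length V : Prop :=
  exists l : nat, forall (m : nat) (N : nat -> set V),
    (forall i, (i <= m)%N -> is_submodule (N i)) ->
    (forall i, (i < m)%N -> N i `<` N i.+1) -> (m <= l)%N.

Lemma ker_is_submodule M N (f : {linear M -> N}) : is_submodule [set x | f x = 0].
Proof. by split=> [|a x y /= fx fy] /=; rewrite ?linear0 // linearP fx fy scaler0 addr0. Qed.

Lemma range_is_submodule M N (f : {linear M -> N}) : is_submodule (range f).
Proof.
split=> [|a _ _ [x _ <-] [y _ <-]]; first by exists 0; rewrite ?linear0.
by exists (a *: x + y) => //; exact: linearP.
Qed.

Definition kernel M N (f : {linear M -> N}) : lmodType S :=
  submodule_type (ker_is_submodule f).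

Definition cokernel M N (f : {linear M -> N}) : lmodType S :=
  quotient_module (range_is_submodule f).

Definition quasi_isomorphism M N (f : {linear M -> N}) : Prop :=
  finite_length (kernel f) /\ finite_length (cokernel f).

Definition maximal_for M M' (f : {linear M -> M'}) : Prop :=
  [/\ finitely_generated M /\ torsion_free M,
      finitely_generated M' /\ torsion_free M',
      quasi_isomorphism f &
      forall (N : lmodType S) (f' : {linear M -> N}),
        finitely_generated N -> torsion_free N -> quasi_isomorphism f' ->
        exists g : {linear N -> M'}, forall x, g (f' x) = f x].

Definition maximal_module M : Prop := maximal_for (idfun : {linear M -> M}).

End Maximal.

Section Psi.
Context (R : idomainType) (pi : R) (v : {fraction R} -> int).
Context (D : complete_dvr pi v) (nu : rat) (d : nat).
Local Notation E := (calE D nu).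
Local Notation Ed := 'rV[E]_d.

Definition rows_in (S : subringClosed E) : set Ed := [set x | forall j, x 0 j \in S].

Definition is_subring_module (S : subringClosed E) (M : set Ed) : Prop :=
  is_submodule (M : set (restrict_scalars S Ed)).

Definition subring_span (S : subringClosed E) (M : set Ed) : set Ed :=
  submodule_span (M : set (restrict_scalars S Ed)).

Definition Free (S : subringClosed E) : set (set Ed) := [set M |
  [/\ is_subring_module S M, M `<=` rows_in S &
      is_free (M : set (restrict_scalars S Ed))]].

Definition Max : set (set Ed) := [set M |
  M `<=` rows_in (Snu D nu) /\
  exists hM : is_subring_module (Snu D nu) M, maximal_module (submodule_type hM)].

Definition Psi (M : set Ed) : set Ed * set Ed :=
  (subring_span (Spi D nu) M, subring_span (Su D nu) M).

End Psi.

Arguments Free {R pi v D nu d} S _.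
Arguments Max {R pi v} D nu d _.
Arguments Psi {R pi v} D nu d M.

(* Main.v *)
(* Multiply the Gauss valuation by alpha to make it integral.  The field E is
   complete for it and S_(nu,u) is its valuation ring; Weierstrass division makes
   S_(nu,pi) principal, and S_nu satisfies Hilbert's basis theorem by comparing
   leading terms.  Over the two principal rings freeness is automatic.

   Put w = u^alpha / pi^beta, so that S_(nu,pi) = S_nu[1/pi] and S_nu[1/w] is
   dense in S_(nu,u).  For a pair (A, B) spanning the same space, N = A /\ B
   generates A because denominators are powers of pi, and generates B by density.
   Both pi and w lie in the radical of S_nu, so a quasi-isomorphism f from N to a
   torsion-free N' is injective and every y in N' has pi^k y and w^l y in the
   image; dividing back, y comes from A /\ B = N.  Thus f is bijective and N is
   maximal.  Conversely, if M is maximal and N = M_pi /\ M_u, then N / M is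
   finitely generated and killed by powers of pi and w, hence of finite length;
   maximality retracts N onto M, which forces M = N. *)
From HB Require Import structures.
Require Import Defs.
From mathcomp Require Import all_boot all_order all_algebra all_classical.
From mathcomp Require Import zify ring.

Set Implicit Arguments.
Unset Strict Implicit.
Unset Printing Implicit Defensive.
Import Order.TTheory GRing.Theory Num.Theory.
Local Open Scope classical_set_scope.
Local Open Scope ring_scope.

Local Notation "x %:F" := (tofrac x).

(** * Gauss valuation and order on E *)

Section Weights.
Context (R : idomainType) (pi : R) (v : {fraction R} -> int).
Context (D : complete_dvr pi v) (nu : rat).
Local Notation K := {fraction R}.
Local Notation E := (calE D nu).
Local Notation al := (denq nu).
Local Notation be := (numq nu).
Implicit Types (a b c : K) (i j m n : int) (f g h : E).

(** Scaled by [al], the weight [v a + nu i] is an integer, so a set of weights bounded below has a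
    least element. The first disjunct gives 0 the weight +oo. *)
Definition wge a i m : bool := (a == 0) || (m <= al * v a + be * i).

Definition ige f m : Prop := forall i, wge (coef f i) i m.

Lemma wgeE a i m : wge a i m = val_ge v a ((m - be * i)%:~R / al%:~R).
Proof.
have al0 : 0 < al%:~R :> rat by rewrite ltr0z denq_gt0.
rewrite /wge /val_ge ler_pdivrMr // -intrM ler_int; congr orb; lia.
Qed.

Lemma gauss_wge (x : int -> K) i m : gauss_ge v nu x i (m%:~R / al%:~R) = wge (x i) i m.
Proof.
have al0 : al%:~R != 0 :> rat by rewrite intr_eq0 denq_neq0.
rewrite gauss_geE wgeE -{2}(divq_num_den nu) rmorphB rmorphM /=; congr (val_ge _ _ _).
by rewrite mulrBl; congr (_ - _); rewrite mulrAC.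
Qed.

Lemma wge0 i m : wge 0 i m. Proof. by rewrite /wge eqxx. Qed.

Lemma wgeW a i m m' : m' <= m -> wge a i m -> wge a i m'.
Proof. by rewrite /wge => mm /orP[->//|H]; rewrite (le_trans mm) ?orbT. Qed.

Lemma wgeD a b i m : wge a i m -> wge b i m -> wge (a + b) i m.
Proof. by rewrite !wgeE; apply: (val_geD D). Qed.

Lemma wgeN a i m : wge a i m -> wge (- a) i m.
Proof. by rewrite !wgeE; apply: (val_geN D). Qed.

Lemma igeW f m m' : m' <= m -> ige f m -> ige f m'.
Proof. by move=> mm fm i; apply: wgeW (fm i). Qed.

Lemma ige0 m : ige 0 m. Proof. by move=> i; apply: wge0. Qed.

Lemma coefD f g i : coef (f + g) i = coef f i + coef g i. Proof. by []. Qed.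
Lemma coefN f i : coef (- f) i = - coef f i. Proof. by []. Qed.
Lemma coef0 i : coef (0 : E) i = 0. Proof. by []. Qed.

Lemma coef_sum (I : Type) (r : seq I) (F : I -> E) i :
  coef (\sum_(k <- r) F k) i = \sum_(k <- r) coef (F k) i.
Proof.
elim: r => [|k r IH]; first by rewrite !big_nil.
by rewrite !big_cons coefD IH.
Qed.

Lemma coef_ext f g : (forall i, coef f i = coef g i) -> f = g.
Proof. by move=> fg; apply/val_inj/funext. Qed.

Lemma igeD f g m : ige f m -> ige g m -> ige (f + g) m.
Proof. by move=> fm gm i; rewrite coefD; apply: wgeD. Qed.

Lemma igeN f m : ige f m -> ige (- f) m.
Proof. by move=> fm i; rewrite coefN; apply: wgeN. Qed.

Lemma igeM f g m n : ige f m -> ige g n -> ige (f * g) (m + n).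
Proof.
move=> fm gn i; rewrite -(gauss_wge (coef (f * g))) intrD mulrDl.
by apply: (series_mul_ge D (valP f) (valP g)) => j; rewrite gauss_wge; [exact: fm|exact: gn].
Qed.

Lemma int_gauss (C : rat) : exists m : int, C <= m%:~R / al%:~R.
Proof.
have al0 : 0 < al%:~R :> rat by rewrite ltr0z denq_gt0.
have [n Cn] := nat_ge (C * al%:~R).
by exists n%:Z; rewrite ler_pdivlMr.
Qed.

Lemma gauss_geW (x : int -> K) i (C C' : rat) : C' <= C -> gauss_ge v nu x i C -> gauss_ge v nu x i C'.
Proof. by rewrite !gauss_geE => CC; apply: val_geW; rewrite lerD2r. Qed.

Lemma ige_has f : exists m, ige f m.
Proof.
have /laurentP[[C H] _] := valP f; have [m Cm] := int_gauss (- C).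
exists (- m) => i; rewrite -(gauss_wge (coef f)); apply: gauss_geW (H i).
by rewrite intrN mulNr lerNl.
Qed.

Lemma ninfty_wge f m : exists N, forall i, i <= N -> wge (coef f i) i m.
Proof.
have /laurentP[_ /(_ (m%:~R / al%:~R))[N H]] := valP f.
by exists N => i iN; rewrite -(gauss_wge (coef f)); apply: H.
Qed.

Lemma laurent_intro (x : int -> K) m0 : (forall i, wge (x i) i m0) ->
  (forall m, exists N, forall i, i <= N -> wge (x i) i m) ->
  x \in is_laurent v nu.
Proof.
move=> x1 x2; apply/laurentP; split.
  by exists (m0%:~R / al%:~R) => i; rewrite gauss_wge.
move=> C; have [m Cm] := int_gauss C; have [N H] := x2 m.
by exists N => i iN; apply: gauss_geW Cm _; rewrite gauss_wge H.
Qed.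

Lemma wge_eq0 a i : (forall m, wge a i m) -> a = 0.
Proof.
by move=> /(_ (al * v a + be * i + 1)) /orP[/eqP//|]; rewrite gerDl.
Qed.

Lemma ige_eq0 f : (forall m, ige f m) -> f = 0.
Proof. by move=> fm; apply: coef_ext => i; rewrite coef0; apply: wge_eq0 (fm^~ i). Qed.

Lemma bounded_below_laurent (x : int -> K) m0 N : (forall i, wge (x i) i m0) ->
  (forall i, i < N -> x i = 0) -> x \in is_laurent v nu.
Proof.
move=> x1 x2; apply: (laurent_intro x1) => m; exists (N - 1) => i iN.
by rewrite x2 ?wge0 //; lia.
Qed.

Lemma mono_laurent c n : (fun i => if i == n then c else 0) \in is_laurent v nu.
Proof.
apply: (@bounded_below_laurent _ (al * v c + be * n) n) => i.
  by case: eqP => [->|_]; rewrite ?wge0 // /wge lexx orbT.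
by case: eqP => // ->; rewrite ltxx.
Qed.

Definition mono c n : E := Sub (fun i => if i == n then c else 0) (mono_laurent c n).

Lemma coef_mono c n i : coef (mono c n) i = if i == n then c else 0.
Proof. by []. Qed.

Lemma coef_monoM c n f i : coef (mono c n * f) i = c * coef f (i - n).
Proof.
rewrite Defs.coefM; apply: (usumE D).
have /(_ _)/= := @has_sum1 _ v int (fun j => coef (mono c n) j * coef f (i - j)) n.
by rewrite coef_mono eqxx; apply => j /negPf jn; rewrite coef_mono jn mul0r.
Qed.

Lemma monoM c c' n n' : mono c n * mono c' n' = mono (c * c') (n + n').
Proof.
apply: coef_ext => i; rewrite coef_monoM !coef_mono.
by have [|] := eqVneq (i - n) n'; have [|] := eqVneq i (n + n'); rewrite ?mulr0 //; lia.
Qed.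

Lemma mono10 : mono 1 0 = 1.
Proof. by apply: coef_ext => i; rewrite coef_mono Defs.coef1; case: eqP. Qed.

Lemma mono_ige c n m : wge c n m -> ige (mono c n) m.
Proof. by move=> cm i; rewrite coef_mono; case: eqP => [->|_]; rewrite ?wge0. Qed.

Lemma hi_laurent n f : (fun i => if n <= i then coef f i else 0) \in is_laurent v nu.
Proof.
have [m fm] := ige_has f; apply: (@bounded_below_laurent _ m n) => i.
  by case: ifP => // _; apply: wge0.
by case: leP.
Qed.

Definition hi n f : E := Sub (fun i => if n <= i then coef f i else 0) (hi_laurent n f).

Lemma coef_hi n f i : coef (hi n f) i = if n <= i then coef f i else 0.
Proof. by []. Qed.

Lemma hi_ige n f m : ige f m -> ige (hi n f) m.
Proof. by move=> fm i; rewrite coef_hi; case: ifP => // _; apply: wge0. Qed.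

Lemma hiD n f g : hi n (f + g) = hi n f + hi n g.
Proof. by apply: coef_ext => i; rewrite coefD !coef_hi coefD; case: ifP; rewrite ?addr0. Qed.

Lemma hiN n f : hi n (- f) = - hi n f.
Proof. by apply: coef_ext => i; rewrite coefN !coef_hi coefN; case: ifP; rewrite ?oppr0. Qed.

(** The u-adic order, the second filtration besides the weight: [Spi] is order at least 0, [Su] is
    weight at least 0, and [Snu] is both. *)
Definition ord_ge f n : Prop := forall i, i < n -> coef f i = 0.

Lemma ord_geW f n n' : n' <= n -> ord_ge f n -> ord_ge f n'.
Proof. by move=> nn fn i ni; apply: fn; lia. Qed.

Lemma ord_geD f g n : ord_ge f n -> ord_ge g n -> ord_ge (f + g) n.
Proof. by move=> fn gn i ni; rewrite coefD fn ?gn ?addr0. Qed.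

Lemma ord_geN f n : ord_ge f n -> ord_ge (- f) n.
Proof. by move=> fn i ni; rewrite coefN fn ?oppr0. Qed.

Lemma ord_geB f g n : ord_ge f n -> ord_ge g n -> ord_ge (f - g) n.
Proof. by move=> fn gn; apply/ord_geD/ord_geN. Qed.

Lemma ord_ge_sum (I : Type) (r : seq I) (F : I -> E) n :
  (forall k, ord_ge (F k) n) -> ord_ge (\sum_(k <- r) F k) n.
Proof.
move=> H; apply: (big_ind (ord_ge^~ n)) => // *; exact: ord_geD.
Qed.

Lemma ord_geM f g m n : ord_ge f m -> ord_ge g n -> ord_ge (f * g) (m + n).
Proof.
move=> fm gn i imn; rewrite Defs.coefM; apply: (usumE D).
suff -> : (fun j => coef f j * coef g (i - j)) = fun=> 0.
  by move=> C; exists [::] => r _ _; rewrite big1 // subrr val_ge0.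
apply/funext => j; have [j0|j0] := ltP j m; first by rewrite fm ?mul0r.
by rewrite [coef g _]gn ?mulr0 //; lia.
Qed.

Lemma ord_ge_eq0 f : (forall n, ord_ge f n) -> f = 0.
Proof. by move=> fn; apply: coef_ext => i; rewrite (fn (i + 1)) //; lia. Qed.

Lemma ord_ge_hi n f : ord_ge (hi n f) n.
Proof. by move=> i; rewrite coef_hi; case: leP. Qed.

Lemma ord_ge_mono c n : ord_ge (mono c n) n.
Proof. by move=> i; rewrite coef_mono; case: eqP => // ->; rewrite ltxx. Qed.

Lemma SpiP f : f \in Spi D nu <-> ord_ge f 0.
Proof. by split=> [/asboolP|H]; last exact/asboolP. Qed.

Lemma SuP f : f \in Su D nu <-> ige f 0.
Proof.
by split=> [/asboolP H i|H]; [|apply/asboolP => i]; have := H i; rewrite -(gauss_wge (coef f)) mul0r.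
Qed.

Lemma SnuP f : f \in Snu D nu <-> f \in Spi D nu /\ f \in Su D nu.
Proof. by have := SnuE f; rewrite /= => ->; split=> /andP. Qed.

End Weights.

(** * Completeness *)

Section Completeness.
Context (R : idomainType) (pi : R) (v : {fraction R} -> int).
Context (D : complete_dvr pi v) (nu : rat).
Local Notation K := {fraction R}.
Local Notation E := (calE D nu).
Local Notation al := (denq nu).
Local Notation be := (numq nu).
Implicit Types (a b c : K) (i j m : int) (f g h : E).

Lemma pi_neq0 : pi%:F != 0.
Proof. by rewrite tofrac_eq0 (uniformizer_neq0 D). Qed.

Lemma vV a : a != 0 -> v a^-1 = - v a.
Proof.
move=> a0; have a1 : a^-1 != 0 by rewrite invr_eq0.
by have := valuationM D a0 a1; rewrite divff // (v1 D); lia.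
Qed.

Lemma v_expz i : v (pi%:F ^ i) = i.
Proof.
case: i => n; first exact: vX D n.
by rewrite NegzE -exprnN vV ?expf_neq0 ?pi_neq0 // (vX D).
Qed.

(** Completeness of E for the Gauss valuation: coefficients are summed one by one in K. The last
    clause keeps order bounds in the limit. *)
Lemma ige_sum_cvg (x : nat -> E) m : (forall n : nat, ige (x n) (m + n%:Z)) ->
  exists s, (forall n : nat, ige (s - \sum_(0 <= k < n) x k) (m + n%:Z)) /\
    forall N, (forall n, ord_ge (x n) N) -> ord_ge s N.
Proof.
move=> xm.
have tail (n k : nat) i : k \notin index_iota 0 n ->
    val_ge v (coef (x k) i) ((m + n%:Z - be * i)%:~R / al%:~R).
  rewrite mem_index_iota /= -leqNgt => nk; rewrite -wgeE; apply: wgeW (xm k i); lia.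
have nul i : null_family v (fun k => coef (x k) i).
  move=> C; have [m' Cm'] := int_gauss nu C.
  exists (index_iota 0 (absz (m' - m + be * i))) => k ki; apply: val_geW (tail _ _ i ki).
  apply: le_trans Cm' _; rewrite ler_pM2r ?ler_int; first by lia.
  by rewrite invr_gt0 ltr0z denq_gt0.
pose s i := usum v (fun k => coef (x k) i).
have sT (n : nat) i : wge v nu (s i - coef (\sum_(0 <= k < n) x k) i) i (m + n%:Z).
  rewrite wgeE coef_sum.
  by apply: (has_sum_tail D (usumP D (nul i)) (fun k => tail n k i)) => //; exact: iota_uniq.
have sE : s \in is_laurent v nu.
  apply: (@laurent_intro _ _ _ _ m) => [i|M].
    by have := sT 0%N i; rewrite big_geq // coef0 subr0 addr0.
  (* The remainder after [n] terms has weight at least [M], so the decay of [s] at -oo reduces to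
     that of a single partial sum. *)
  pose n := absz (M - m); have [N H] := ninfty_wge (\sum_(0 <= k < n) x k) M.
  exists N => i iN; rewrite -(subrK (coef (\sum_(0 <= k < n) x k) i) (s i)).
  by apply: (wgeD D); [apply: wgeW (sT n i); lia|exact: H].
exists (Sub s sE : E); split=> [n i|N xN i iN]; first exact: sT.
change (s i = 0); apply: (usumE D).
suff -> : (fun k => coef (x k) i) = fun=> 0.
  by move=> C; exists [::] => r _ _; rewrite big1 // subrr val_ge0.
by apply/funext => k; apply: xN.
Qed.

(** Since [T] raises weights, the Neumann series [y - T y + T (T y) - ...] inverts [1 + T]. This
    serves both to invert series and to divide with remainder. *)
Lemma contraction_surj (T : E -> E) y m : {morph T : x z / x - z} ->
  (forall x n, ige x n -> ige (T x) (n + 1)) -> ige y m ->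
  exists q, [/\ q + T q = y, ige q m &
    forall N, (forall x, ord_ge x N -> ord_ge (T x) N) -> ord_ge y N -> ord_ge q N].
Proof.
move=> TB Tc ym.
have T0 : T 0 = 0 by rewrite -[X in T X](subrr 0) TB subrr.
have TN z : T (- z) = - T z by rewrite -[- z]sub0r TB T0 sub0r.
have TD x z : T (x + z) = T x + T z by rewrite -{1}[z]opprK TB TN opprK.
pose x n := iter n (fun z => - T z) y.
have xm n : ige (x n) (m + n%:Z).
  elim: n => [|n IH]; first by rewrite addr0.
  apply: igeN; have /= := Tc _ _ IH; apply: igeW; lia.
have [q [qE qN]] := ige_sum_cvg xm.
(* Telescoping: [1 + T] maps the partial sum to [y - x n]. *)
have partial n : \sum_(0 <= k < n) x k + T (\sum_(0 <= k < n) x k) - y = - x n.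
  elim: n => [|n IH]; first by rewrite big_geq // T0 addr0 sub0r.
  rewrite big_nat_recr //= TD; move: IH; set A := \sum_(0 <= k < n) x k.
  rewrite opprK => IH; have -> : A + x n + (T A + T (x n)) - y = (A + T A - y) + (x n + T (x n)).
    by ring.
  by rewrite IH addKr.
exists q; split; last first.
- move=> N TN' yN; apply: qN; elim=> [//|n IH] /=.
  exact/ord_geN/TN'.
- by have := qE 0%N; rewrite big_geq // subr0 addr0.
apply/subr0_eq/(@ige_eq0 _ _ _ _ nu) => M.
pose n := absz (M - m); pose A := \sum_(0 <= k < n) x k.
have -> : q + T q - y = (q - A) + T (q - A) + (A + T A - y).
  by rewrite TB; ring.
rewrite partial; apply: (@igeW _ _ _ _ _ _ (m + n%:Z)); first by lia.
apply: (igeD); last exact/igeN.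
by apply: igeD; [exact: qE|apply: igeW (Tc _ _ (qE n)); lia].
Qed.

Lemma ige1 : ige (1 : E) 0.
Proof. by rewrite -mono10; apply: mono_ige; rewrite /wge (v1 D) !mulr0 addr0 lexx orbT. Qed.

Lemma ord_ge1 : ord_ge (1 : E) 0.
Proof. by rewrite -mono10; apply: ord_ge_mono. Qed.

Lemma one_add_inv h : ige h 1 ->
  exists q, [/\ (1 + h) * q = 1, ige q 0 & (ord_ge h 0 -> ord_ge q 0)].
Proof.
move=> h1; have [||q [qE q0 qN]] := @contraction_surj (fun x => h * x) 1 0 _ _ ige1.
- by move=> x z; rewrite mulrBr.
- by move=> x n xn; rewrite addrC; apply: igeM.
exists q; split=> // [|h0]; first by rewrite mulrDl mul1r.
apply: qN => [x x0|]; last exact: ord_ge1.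
by rewrite -[0]addr0; apply: ord_geM.
Qed.

(** u-adic completeness of [Snu]. Terms of index above [absz i] do not touch the coefficient of
    exponent [i], so each coefficient is a finite sum and integrality passes to the limit. *)
Lemma ord_sum_cvg (x : nat -> E) : (forall n, x n \in Snu D nu) ->
  (forall n : nat, ord_ge (x n) n%:Z) ->
  exists2 s, s \in Snu D nu & forall n : nat, ord_ge (s - \sum_(0 <= k < n) x k) n%:Z.
Proof.
move=> xS xn; pose s i := coef (\sum_(0 <= k < (absz i).+1) x k) i.
have S0 n : \sum_(0 <= k < n) x k \in Snu D nu by apply: rpred_sum.
have sE : s \in is_laurent v nu.
  apply: (@bounded_below_laurent _ _ _ _ 0 0) => i.
    by have /SnuP[_ /SuP] := S0 (absz i).+1; apply.
  by have /SnuP[/SpiP H _] := S0 (absz i).+1; apply: H.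
have xi (n : nat) i : i < n -> coef (\sum_(0 <= k < n) x k) i = s i.
  have aux (a b : nat) : i < a -> (a <= b)%N ->
      coef (\sum_(0 <= k < b) x k) i = coef (\sum_(0 <= k < a) x k) i.
    move=> ia ab; rewrite (big_cat_nat (n := a)) //= coefD.
    rewrite -[RHS]addr0; congr (_ + _); rewrite coef_sum big_nat big1 // => k /andP[ak _].
    by apply: xn; lia.
  move=> i_n; rewrite /s; have [ab|ab] := leqP n (absz i).+1.
    by rewrite (aux n).
  by rewrite (aux (absz i).+1) //; lia.
exists (Sub s sE : E).
  apply/SnuP; split; [apply/SpiP|apply/SuP] => i; change (coef (Sub s sE : E) i) with (s i).
    by have /SnuP[/SpiP H _] := S0 (absz i).+1; apply: H.
  by have /SnuP[_ /SuP] := S0 (absz i).+1; apply.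
by move=> n i i_n; rewrite Defs.coefB xi // subrr.
Qed.

(** The weight of [h] may be 0, so the geometric series converges by growth of the order instead of
    the weight. *)
Lemma one_sub_inv h : h \in Snu D nu -> ord_ge h 1 ->
  exists2 q, q \in Snu D nu & (1 - h) * q = 1.
Proof.
move=> hS h1.
have ho n : ord_ge (h ^+ n) n%:Z.
  elim: n => [|n IH]; first exact: ord_ge1.
  by rewrite exprS intS; apply: ord_geM.
have [|q qS qE] := ord_sum_cvg _ ho; first by move=> n; apply: rpredX.
exists q => //; apply/subr0_eq/(@ord_ge_eq0 _ _ _ _ nu) => n.
apply: (@ord_geW _ _ _ _ _ _ (absz n)%:Z); first lia.
set N := absz n; pose A := \sum_(0 <= k < N) h ^+ k.
have -> : (1 - h) * q - 1 = (1 - h) * (q - A) - h ^+ N.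
  have -> : h ^+ N = 1 - (1 - h) * A.
    rewrite /A big_mkord; have := subrX1 h N => H.
    by rewrite -[1 - h]opprB mulNr -H opprK addrC subrK.
  by ring.
apply: ord_geB => //; rewrite -[N%:Z]add0r; apply: ord_geM (qE N).
apply: ord_geB; first exact: ord_ge1.
by apply: ord_geW h1.
Qed.

End Completeness.

(** * Ideals of the three rings *)

Section Ideals.
Context (E : comNzRingType) (S : subringClosed E).

(** Ideals are kept as subsets of E, where their members can be inverted and truncated. *)
Definition is_ideal (I : set E) : Prop :=
  [/\ forall x, I x -> x \in S, I 0 & forall a x y, a \in S -> I x -> I y -> I (a * x + y)].

Definition principal_ideals : Prop := forall I, is_ideal I ->
  exists2 x, I x & forall y, I y -> exists2 a, a \in S & y = a * x.

Definition fg_ideals : Prop := forall I, is_ideal I ->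
  exists n (g : 'I_n -> E), (forall i, I (g i)) /\
    forall y, I y -> exists c : 'I_n -> E, (forall i, c i \in S) /\ y = \sum_i c i * g i.

Lemma is_ideal_sum I n (c g : 'I_n -> E) : is_ideal I -> (forall i, c i \in S) ->
  (forall i, I (g i)) -> I (\sum_i c i * g i).
Proof.
case=> _ I0 IL cS gI; elim/big_rec: _ => // i x _ Ix; exact: IL.
Qed.

Lemma principal_fg : principal_ideals -> fg_ideals.
Proof.
move=> prS I hI; have [x Ix xE] := prS I hI.
exists 1%N, (fun=> x); split=> // y /xE[a aS ->].
by exists (fun=> a); rewrite big_ord1.
Qed.

End Ideals.

(** * Inversion, Weierstrass division and the ideals of the three rings *)

Section RingsOfE.
Context (R : idomainType) (pi : R) (v : {fraction R} -> int).
Context (D : complete_dvr pi v) (nu : rat).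
Local Notation E := (calE D nu).
Local Notation al := (denq nu).
Local Notation be := (numq nu).
Implicit Types (f g h : E).

Lemma int_min (P : int -> Prop) N : (exists i, P i) -> (forall i, P i -> N <= i) ->
  exists2 i, P i & forall j, P j -> i <= j.
Proof.
move=> [i0 Pi0] PN.
have ex : exists k : nat, `[< P (N + k%:Z) >].
  exists (absz (i0 - N)); apply/asboolP; have := PN _ Pi0 => Ni.
  by have -> : N + `|i0 - N|%N = i0 by lia.
case: (ex_minnP ex) => k /asboolP Pk kmin; exists (N + k%:Z) => // j Pj.
have := PN _ Pj => Nj; suff /kmin : `[< P (N + `|j - N|%N) >] by lia.
by apply/asboolP; have -> : N + `|j - N|%N = j by lia.
Qed.

(* n is the Weierstrass degree of g, and m / al its Gauss valuation. *)
Definition leading g n m : Prop :=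
  [/\ coef g n != 0, m = al * v (coef g n) + be * n, ige g m &
      forall i, i < n -> wge v nu (coef g i) i (m + 1)].

(** Two minimisations: the weight first, then the exponent among terms of least weight. The second
    minimum exists because weights tend to +oo at -oo. *)
Lemma leading_exists g : g != 0 -> exists n m, leading g n m.
Proof.
move=> g0; have [m0 gm0] := ige_has g.
have exg : exists i, coef g i != 0.
  apply: contrapT => ng; case/eqP: g0; apply: coef_ext => i.
  by have [//|gi] := eqVneq (coef g i) 0; case: ng; exists i.
pose W i := al * v (coef g i) + be * i.
have [||m [i1 gi1 mi1] mmin] := @int_min (fun m => exists2 i, coef g i != 0 & m = W i) m0.
- by case: exg => i gi; exists (W i), i.
- by move=> m [i gi mi]; have := gm0 i; rewrite /wge (negPf gi) -/(W i) -mi.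
have gm : ige g m.
  move=> i; rewrite /wge; have [//|gi] := eqVneq (coef g i) 0.
  by apply: mmin; exists i.
have [N gN] := ninfty_wge g (m + 1).
have [||n [gn mn] nmin] := @int_min (fun i => coef g i != 0 /\ m = W i) N.
- by exists i1.
- move=> i [gi mi]; have := gN i; rewrite /wge (negPf gi) /= -/(W i) -mi => H.
  by case: (leP N i) => // iN; have := H (ltW iN); lia.
exists n, m; split=> // i i_n; rewrite /wge; have [//|gi] := eqVneq (coef g i) 0.
have Wm : m <= W i by apply: mmin; exists i.
rewrite /= -/(W i); have [Wi|Wi] := eqVneq m (W i); last by lia.
by have := nmin i (conj gi Wi); lia.
Qed.

(** Dividing by the leading monomial turns [hi n g] into an element of [Snu] with constant term 1,
    which the geometric series inverts. *)
Lemma hi_inv g n m : leading g n m ->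
  exists q, [/\ hi n g * q = 1, ige q (- m) & ord_ge q (- n)].
Proof.
move=> [gn mE gm _]; pose c := coef g n; pose k := mono D nu c^-1 (- n).
have kw : ige k (- m).
  by apply: mono_ige; apply/orP; right; rewrite (vV D) // mE /c; lia.
have hk : ige (k * hi n g) 0.
  by rewrite -[0](addNr m); apply: igeM => //; apply: hi_ige.
have ok : ord_ge (k * hi n g) 0.
  by rewrite -[0](addNr n); apply: ord_geM; [exact: ord_ge_mono|exact: ord_ge_hi].
have [||q qS qE] := @one_sub_inv _ _ _ D nu (1 - k * hi n g).
- apply: rpredB; first exact: rpred1.
  by apply/SnuP; split; [apply/SpiP|apply/SuP].
- move=> i i1; have [i0|i0] := ltP i 0.
    by apply: (ord_geB (@ord_ge1 _ _ _ _ _) ok).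
  have -> : i = 0 by lia.
  by rewrite Defs.coefB coef_monoM coef_hi Defs.coef1 eqxx sub0r opprK lexx mulVf ?subrr.
have /SnuP[/SpiP q0 /SuP qw] := qS.
exists (k * q); split; last by rewrite -[- n]addr0; apply: ord_geM => //; exact: ord_ge_mono.
  by rewrite -qE; ring.
by rewrite -[- m]addr0; apply: igeM.
Qed.

(** Weights below the Weierstrass degree exceed [m] strictly, so the lower part is a small
    perturbation of [hi n g]. *)
Lemma lo_ige g n m : leading g n m -> ige (g - hi n g) (m + 1).
Proof.
move=> [_ _ gm glo] i; rewrite Defs.coefB coef_hi; case: leP => [_|i_n].
  by rewrite subrr wge0.
by rewrite subr0 glo.
Qed.

(** Multiplying [g] by the inverse of its upper part gives 1 plus an element of weight at least
    1. *)
Lemma leading_inv g n m : leading g n m -> exists2 q, g * q = 1 & ige q (- m).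
Proof.
move=> gl; have [u [hu uw _]] := hi_inv gl.
have lw : ige ((g - hi n g) * u) 1.
  by rewrite -[1](addrK m) [1 + m]addrC; apply: igeM => //; apply: lo_ige.
have [q [qE qw _]] := one_add_inv lw.
exists (u * q); last by rewrite -[- m]addr0; apply: igeM.
by rewrite -qE -[X in (X + _) * _]hu; ring.
Qed.

Lemma calE_inv g : g != 0 -> exists q, g * q = 1.
Proof. by move=> /leading_exists[n [m /leading_inv[q]]]; exists q. Qed.

(** An element of least Gauss valuation generates, since quotients by it have weight at least 0. *)
Lemma Su_principal : principal_ideals (Su D nu).
Proof.
move=> I [IS I0 IL].
have [[g [Ig g0]]|nI] := pselect (exists g, I g /\ g != 0); last first.
  exists 0 => // y Iy; exists 0; first exact: rpred0.
  by rewrite mulr0; apply: contrapT => /eqP y0; case: nI; exists y.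
have [||m [h [n [Ih hl]]] mmin] :=
    @int_min (fun m => exists h n, I h /\ leading h n m) 0.
- by have [n [m gl]] := leading_exists g0; exists m, g, n.
- move=> m [h [n [Ih [hn -> _ _]]]]; have /SuP/(_ n) := IS _ Ih.
  by rewrite /wge (negPf hn).
have [q hq qw] := leading_inv hl.
exists h => // y Iy; exists (y * q); last by rewrite -mulrA [q * h]mulrC hq mulr1.
apply/SuP; rewrite -[0](subrr m); apply: igeM => //.
have [->|y0] := eqVneq y 0; first exact: ige0.
have [n' [m' yl]] := leading_exists y0; have [_ _ ym _] := yl.
by apply: igeW ym; apply: mmin; exists y, n'.
Qed.

(** With [u] the inverse of [hi n g] and [q = p * u], the condition on [q] reads [p + hi n (p * (u *
    (g - hi n g))) = hi n f]. The second term is a contraction in [p]. *)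
Lemma weierstrass_division f g n m : leading g n m -> f \in Spi D nu ->
  exists2 q, q \in Spi D nu & hi n (f - q * g) = 0.
Proof.
move=> gl /SpiP f0; have [u [hu uw uo]] := hi_inv gl.
have lw : ige (u * (g - hi n g)) 1.
  by rewrite -[1](addKr m); apply: igeM => //; apply: lo_ige.
have [mf fm] := ige_has f.
have [||p [pE _ po]] := @contraction_surj _ _ _ D nu
    (fun x => hi n (x * (u * (g - hi n g)))) (hi n f) mf _ _ (hi_ige n fm).
- by move=> x z; rewrite mulrBl hiD hiN.
- by move=> x k xk; apply/hi_ige/igeM.
(* Every value of the contraction is truncated at [n], so [p] has order at least [n]; this offsets
   the order [- n] of [u]. *)
have {}po : ord_ge p n by apply: po => *; apply: ord_ge_hi.
have hp : hi n p = p.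
  by apply: coef_ext => i; rewrite coef_hi; case: leP => // /po.
exists (p * u); first by apply/SpiP; rewrite -[0](subrr n); apply: ord_geM.
have -> : f - p * u * g = f - p - p * (u * (g - hi n g)).
  have -> : p * u * g = p * (hi n g * u) + p * (u * (g - hi n g)) by ring.
  by rewrite hu; ring.
by rewrite !hiD !hiN hp -pE addrAC addrK subrr.
Qed.

(** An element of least Weierstrass degree generates: a nonzero remainder would have all its
    exponents below that degree. *)
Lemma Spi_principal : principal_ideals (Spi D nu).
Proof.
move=> I [IS I0 IL].
have [[g [Ig g0]]|nI] := pselect (exists g, I g /\ g != 0); last first.
  exists 0 => // y Iy; exists 0; first exact: rpred0.
  by rewrite mulr0; apply: contrapT => /eqP y0; case: nI; exists y.
have [||n [h [m [Ih hl]]] nmin] :=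
    @int_min (fun n => exists h m, I h /\ leading h n m) 0.
- by have [n [m gl]] := leading_exists g0; exists n, g, m.
- move=> n [h [m [Ih [hn _ _ _]]]]; have /SpiP h0 := IS _ Ih.
  by case: leP => // /h0 E0; rewrite E0 eqxx in hn.
exists h => // y Iy; have [q qS qE] := weierstrass_division hl (IS _ Iy).
exists q => //; apply/eqP; rewrite -subr_eq0; apply: contrapT => /negP r0.
have [n' [m' rl]] := leading_exists r0; have [rn _ _ _] := rl.
have Ir : I (y - q * h) by rewrite addrC -mulNr; apply: IL => //; exact: rpredNr.
have nn : n <= n' by apply: nmin; exists (y - q * h), m'.
by move: rn; have := congr1 (fun z => coef z n') qE; rewrite coef_hi nn => ->; rewrite coef0 eqxx.
Qed.

(* A nonzero leading term of least weight among the allowed orders divides the later ones. *)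
Lemma ideal_reduction (I : set E) (P : nat -> Prop) : is_ideal (Snu D nu) I ->
  exists (n0 : nat) f0, [/\ I f0, P n0 \/ n0 = 0%N &
    forall (n : nat) f, (n0 <= n)%N -> P n -> I f -> ord_ge f n%:Z ->
      exists c, [/\ c \in Snu D nu, ord_ge c (n%:Z - n0%:Z) & ord_ge (f - c * f0) n.+1%:Z]].
Proof.
move=> [IS I0 IL].
pose Q m := exists (n : nat) f, [/\ P n, I f, ord_ge f n%:Z, coef f n%:Z != 0 &
  m = al * v (coef f n%:Z) + be * n%:Z].
have ordS f (n : nat) : ord_ge f n%:Z -> coef f n%:Z = 0 -> ord_ge f n.+1%:Z.
  by move=> fn fn0 i i_n; have [->//|ne] := eqVneq i n%:Z; apply: fn; lia.
have [exQ|nQ] := pselect (exists m, Q m); last first.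
  (* No leading term at an allowed order: members of I already gain one order there, so 0 reduces
     them and the index 0 is a dummy. *)
  exists 0%N, 0; split=> //; first by right.
  move=> n f _ Pn If fn; exists 0; split; [exact: rpred0|by []|rewrite mul0r subr0].
  apply: ordS => //; apply: contrapT => /eqP f0; apply: nQ.
  by exists (al * v (coef f n%:Z) + be * n%:Z), n, f.
have [|m [n0 [f0 [Pn0 If0 fo fn mE]]] mmin] := @int_min Q 0 exQ.
  move=> m [n [f [_ If _ fn ->]]]; have /SnuP[_ /SuP/(_ n%:Z)] := IS _ If.
  by rewrite /wge (negPf fn).
exists n0, f0; split=> //; first by left.
move=> n f nn Pn If fo'.
have [fn0|fn'] := eqVneq (coef f n%:Z) 0.
  exists 0; split; [exact: rpred0|by []|rewrite mul0r subr0].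
  exact: ordS.
pose c := coef f n%:Z / coef f0 n0%:Z.
have c0 : c != 0 by rewrite mulf_neq0 ?invr_eq0.
exists (mono D nu c (n%:Z - n0%:Z)); split; last 1 first.
- apply: ordS.
    apply: ord_geB => //; apply: (@ord_geW _ _ _ _ _ _ (n%:Z - n0%:Z + n0%:Z)); first by lia.
    by apply: ord_geM => //; exact: ord_ge_mono.
  rewrite Defs.coefB coef_monoM; have -> : n%:Z - (n%:Z - n0%:Z) = n0%:Z by lia.
  by rewrite divfK ?subrr.
- apply/SnuP; split; [apply/SpiP|apply/SuP].
    by apply: (@ord_geW _ _ _ _ _ _ (n%:Z - n0%:Z)); [lia|exact: ord_ge_mono].
  (* Minimality of [m] makes the weight of the quotient monomial nonnegative. *)
  have := mmin (al * v (coef f n%:Z) + be * n%:Z) => /(_ _) H.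
  apply: mono_ige; rewrite /wge (negPf c0) /= /c (valuationM D) ?invr_eq0 // (vV D) //.
  suff : m <= al * v (coef f n%:Z) + be * n%:Z by rewrite mE; lia.
  by apply: H; exists n, f.
- exact: ord_ge_mono.
Qed.

(** Hilbert basis argument by orders: one reducer [fL] serves all orders from [L] on, and one more
    is taken for each order below [L]. Repeated reduction then converges u-adically. *)
Lemma Snu_fg : fg_ideals (Snu D nu).
Proof.
move=> I hI; have [IS I0 IL] := hI.
have [L [fL [IfL _ redL]]] := ideal_reduction (fun=> True) hI.
have redn (n : nat) : exists f0, I f0 /\ forall f, I f -> ord_ge f n%:Z ->
    exists c, c \in Snu D nu /\ ord_ge (f - c * f0) n.+1%:Z.
  have [n0 [f0 [If0 Pn0 red]]] := ideal_reduction (eq n) hI.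
  exists f0; split=> // f If fn; have [|c [cS _ cE]] := red n f _ erefl If fn; last by exists c.
  (* For the predicate [eq n] the index [n0] is [n] or the dummy 0, both at most [n]. *)
  by case: Pn0 => [->|->].
have [fn fnE] := choice redn.
pose G (i : 'I_L.+1) := if (i < L)%N then fn i else fL.
have GI i : I (G i) by rewrite /G; case: ifP => // _; have [] := fnE i.
have step (p : nat * E) : exists c : 'I_L.+1 -> E, I p.2 -> ord_ge p.2 p.1%:Z ->
    [/\ forall i, c i \in Snu D nu, forall i, ord_ge (c i) (p.1%:Z - L%:Z) &
        ord_ge (p.2 - \sum_i c i * G i) p.1.+1%:Z].
  case: p => n f /=; have [[If fo]|no] := pselect (I f /\ ord_ge f n%:Z); last first.
    by exists (fun=> 0) => If fo; case: no.
  have one (i0 : 'I_L.+1) c : c \in Snu D nu -> ord_ge c (n%:Z - L%:Z) ->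
      ord_ge (f - c * G i0) n.+1%:Z ->
      exists c : 'I_L.+1 -> E, I f -> ord_ge f n%:Z ->
       [/\ forall i, c i \in Snu D nu, forall i, ord_ge (c i) (n%:Z - L%:Z) &
        ord_ge (f - \sum_i c i * G i) n.+1%:Z].
    move=> cS co cE; exists (fun i => if i == i0 then c else 0) => _ _.
    split=> [i|i|]; try by case: ifP => // _; exact: rpred0.
    rewrite (bigD1 i0) //= eqxx big1 ?addr0 // => i /negPf ->; exact: mul0r.
  have [Ln|nL] := leqP L n.
    have [c [cS co cE]] := redL n f Ln Logic.I If fo.
    by apply: (one ord_max c) => //; rewrite /G /= ltnn.
  have [c [cS cE]] := (fnE n).2 f If fo.
  have nL' : (n < L.+1)%N by rewrite ltnS ltnW.
  apply: (one (Ordinal nL') c) => //; last by rewrite /G /= nL.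
  by have /SnuP[/SpiP c0 _] := cS; apply: ord_geW c0; lia.
have [C CE] := choice step.
exists L.+1, G; split=> // f If.
(* Successive remainders: [F n] stays in I and has order at least [n]. *)
pose F := fix F (n : nat) := if n is k.+1 then F k - \sum_i C (k, F k) i * G i else f.
have FE (n : nat) : I (F n) /\ ord_ge (F n) n%:Z.
  elim: n => [|n [IFn oFn]]; first by split=> //; have /SnuP[/SpiP] := IS _ If.
  have [cS _ co] := CE (n, F n) IFn oFn; split=> //=.
  rewrite addrC -sumrN; under eq_bigr do rewrite -mulNr.
  rewrite -[X in I (X + _)]addr0 -addrA add0r -[X in I (X + _)]mul1r.
  apply: IL => //; first exact: rpred1.
  by apply: (is_ideal_sum (S := Snu D nu)) => // i; rewrite rpredN.
have CS (n : nat) i : C (n, F n) i \in Snu D nu by have [] := CE (n, F n) (FE n).1 (FE n).2.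
have Co (n : nat) i : ord_ge (C (n, F n) i) (n%:Z - L%:Z).
  by have [] := CE (n, F n) (FE n).1 (FE n).2.
(* Stage [k + L] contributes coefficients of order at least [k], so the shifted series converges;
   the first [L] stages are added separately in [d]. *)
have lim i : exists s, s \in Snu D nu /\
    forall N : nat, ord_ge (s - \sum_(0 <= k < N) C ((k + L)%N, F (k + L)%N) i) N%:Z.
  have [||s sS sE] := @ord_sum_cvg _ _ _ D nu (fun k => C ((k + L)%N, F (k + L)%N) i).
  - by move=> n; apply: CS.
  - by move=> n; apply: ord_geW (Co _ _); lia.
  by exists s.
have [s sE] := choice lim.
pose d i := \sum_(0 <= k < L) C (k, F k) i + s i.
exists d; split=> [i|].
  by apply: rpredD; [apply: rpred_sum => k _|have [] := sE i].
have FS (n : nat) : f - F n = \sum_i (\sum_(0 <= k < n) C (k, F k) i) * G i.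
  elim: n => [|n IH]; first by rewrite subrr big1 // => i _; rewrite big_geq ?mul0r.
  under eq_bigr do rewrite big_nat_recr //= mulrDl.
  by rewrite big_split /= -IH; ring.
apply/subr0_eq/(@ord_ge_eq0 _ _ _ _ nu) => m.
apply: (@ord_geW _ _ _ _ _ _ (absz m)%:Z); first lia.
set N := absz m.
have -> : f - \sum_i d i * G i = F (N + L)%N -
    \sum_i (d i - \sum_(0 <= k < N + L) C (k, F k) i) * G i.
  under [in RHS]eq_bigr do rewrite mulrBl.
  by rewrite sumrB -[X in _ - (_ - X)]FS opprB addrA subrKC.
apply: ord_geB; first by apply: ord_geW (FE _).2; lia.
apply: ord_ge_sum => i; rewrite -[N%:Z]addr0; apply: ord_geM; last first.
  by have /SnuP[/SpiP] := IS _ (GI i).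
suff -> : d i - \sum_(0 <= k < N + L) C (k, F k) i =
    s i - \sum_(0 <= k < N) C ((k + L)%N, F (k + L)%N) i by have [_] := sE i.
have shift (H : nat -> E) : \sum_(L <= k < N + L) H k = \sum_(0 <= k < N) H (k + L)%N.
  by rewrite -{1}[L]add0n big_addn addnK.
rewrite /d [X in _ - X](big_cat_nat (n := L)) ?leq_addl //= shift.
by rewrite opprD addrA [X in X - _]addrAC subrr add0r.
Qed.

End RingsOfE.

(** * Submodules of free modules *)

Section Submodules.
Context (E : comNzRingType) (S : subringClosed E) (d : nat).
Local Notation Ed := 'rV[E]_d.
Implicit Types (M N X : set Ed).

Definition submod M : Prop := is_submodule (M : set (restrict_scalars S Ed)).

Lemma submodP M :
  submod M <-> M 0 /\ forall a x y, a \in S -> M x -> M y -> M (a *: x + y).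
Proof.
split=> -[M0 ML]; split=> //.
  by move=> a x y aS; apply: (ML (Sub a aS : subring_type S)).
by move=> a x y; apply: ML; exact: valP a.
Qed.

Lemma submod0 M : submod M -> M 0. Proof. by case/submodP. Qed.

Lemma submodZ M a x : submod M -> a \in S -> M x -> M (a *: x).
Proof. by move=> /submodP[M0 ML] aS Mx; rewrite -[_ *: _]addr0; apply: ML. Qed.

Lemma submodD M x y : submod M -> M x -> M y -> M (x + y).
Proof. by move=> /submodP[_ ML] Mx My; rewrite -[x]scale1r; apply: ML; rewrite ?rpred1. Qed.

Lemma submodN M x : submod M -> M x -> M (- x).
Proof. by move=> hM Mx; rewrite -scaleN1r; apply: submodZ => //; rewrite rpredN rpred1. Qed.

Lemma submodB M x y : submod M -> M x -> M y -> M (x - y).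
Proof. by move=> hM Mx My; apply: submodD => //; apply: submodN. Qed.

Lemma submod_sum M (I : finType) (F : I -> Ed) : submod M -> (forall i, M (F i)) ->
  M (\sum_i F i).
Proof.
move=> hM FM; elim/big_rec: _ => [|i x _ Mx]; first exact: submod0.
exact: submodD.
Qed.

Definition span X : set Ed := submodule_span (X : set (restrict_scalars S Ed)).

Lemma sub_span X : X `<=` span X.
Proof. by move=> x Xx A [_]; apply. Qed.

Lemma span_min X M : submod M -> X `<=` M -> span X `<=` M.
Proof. by move=> hM XM x /(_ M); apply. Qed.

Lemma span_submod X : submod (span X).
Proof.
split=> [A [[A0 _] _] //|a x y Xx Xy A hA].
by case: (hA) => -[_ AL] _; apply: AL; [apply: Xx|apply: Xy].
Qed.

Definition generates n (g : 'I_n -> Ed) M : Prop := (forall i, M (g i)) /\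
  forall x, M x -> exists c : 'I_n -> E, (forall i, c i \in S) /\ x = \sum_i c i *: g i.

(** The coefficients range over E and not only over [S], so that a nonzero coordinate can be
    cancelled by its inverse. *)
Definition independent n (g : 'I_n -> Ed) : Prop :=
  forall c : 'I_n -> E, \sum_i c i *: g i = 0 -> forall i, c i = 0.

(** Dévissage by coordinates: a submodule is an extension of its ideal of [k]-th coordinates by the
    part where that coordinate vanishes. *)
Let coord_ind (P : set Ed -> Prop) :
    P [set 0] ->
    (forall M (k : 'I_d), submod M -> (forall x, M x -> forall j, x 0 j \in S) ->
      P [set x | M x /\ x 0 k = 0] -> P M) ->
  forall M, submod M -> (forall x, M x -> forall j, x 0 j \in S) -> P M.
Proof.
move=> P0 PS M hM MS.
(* [k] counts the last coordinates that may be nonzero; for [k = 0] only the zero module is left. *)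
suff H k : (k <= d)%N -> forall M, submod M -> (forall x, M x -> forall j, x 0 j \in S) ->
    (forall x, M x -> forall j : 'I_d, (j < d - k)%N -> x 0 j = 0) -> P M.
  by apply: (H d) => // x _ j; rewrite subnn.
elim: k => [|k IH] kd {}M {}hM {}MS Mk.
  suff -> : M = [set 0] by [].
  apply/seteqP; split=> [x Mx|_ ->]; last exact: submod0.
  by apply/rowP => j; rewrite (Mk x Mx) ?mxE // subn0.
have k0 : (d - k.+1 < d)%N by lia.
pose j0 := Ordinal k0.
apply: (PS M j0) => //; apply: IH; first exact: ltnW.
- apply/submodP; split=> [|a x y aS [Mx x0] [My y0]].
    by split; [exact: submod0|rewrite mxE].
  split; first by apply: submodD => //; apply: submodZ.
  by rewrite !mxE x0 y0 mulr0 addr0.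
- by move=> x [Mx _]; exact: MS.
- move=> x [Mx x0] j jk; have [->//|jj] := eqVneq j j0.
  by apply: Mk => //; move: jj jk; rewrite -val_eqE /=; lia.
Qed.

Lemma coord_ideal M (k : 'I_d) : submod M -> (forall x, M x -> forall j, x 0 j \in S) ->
  is_ideal S [set x 0 k | x in M].
Proof.
move=> hM MS; split=> [_ [x Mx <-]||a _ _ aS [x Mx <-] [y My <-]]; first exact: MS.
  by exists 0; [exact: submod0|rewrite mxE].
by exists (a *: x + y); rewrite ?mxE //; apply: submodD => //; apply: submodZ.
Qed.

(** Lifts of generators of the coordinate ideal, together with generators of the kernel of that
    coordinate, generate. *)
Lemma submod_fg M : fg_ideals S -> submod M -> (forall x, M x -> forall j, x 0 j \in S) ->
  exists n (g : 'I_n -> Ed), generates g M.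
Proof.
move=> fgS; apply: (coord_ind (P := fun M => exists n (g : 'I_n -> Ed), generates g M)).
  exists 0%N, (fun=> 0); split=> // x ->; exists (fun=> 0); split; first by case.
  by rewrite big_ord0.
move=> {}M k hM MS [n2 [g2 [g2M g2E]]].
have [n1 [y [yI yE]]] := fgS _ (coord_ideal k hM MS).
have [g1 g1E] := choice (fun i => let: ex_intro2 x Mx e := yI i in ex_intro _ x (conj Mx e)).
pose g (i : 'I_(n1 + n2)) := match fintype.split i with inl j => g1 j | inr j => g2 j end.
exists (n1 + n2)%N, g; split=> [i|x Mx].
  by rewrite /g; case: fintype.split => j; [have [] := g1E j|have [] := g2M j].
have [c1 [c1S c1E]] := yE (x 0 k) (ex_intro2 _ _ x Mx erefl).
have [|c2 [c2S c2E]] := g2E (x - \sum_i c1 i *: g1 i).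
  split.
    apply: submodB => //; apply: submod_sum => // i; apply: submodZ => //.
    by have [] := g1E i.
  rewrite !mxE summxE c1E -sumrB big1 // => i _.
  by rewrite mxE (g1E i).2 subrr.
exists (fun i => match fintype.split i with inl j => c1 j | inr j => c2 j end); split=> [i|].
  by case: fintype.split.
rewrite big_split_ord /= -[x](subrKC (\sum_i c1 i *: g1 i)) c2E /g.
by congr (_ + _); apply: eq_bigr => i _;
   [rewrite (unsplitK (inl i))|rewrite (unsplitK (inr i))].
Qed.

Context (Einv : forall x : E, x != 0 -> exists y, x * y = 1).

(** Same extension with a single lift [m]. If its coordinate is nonzero, that coordinate separates
    [m] from the kernel; otherwise the kernel is everything. *)
Lemma submod_basis M : principal_ideals S -> submod M ->
  (forall x, M x -> forall j, x 0 j \in S) ->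
  exists n (g : 'I_n -> Ed), generates g M /\ independent g.
Proof.
move=> prS.
apply: (coord_ind (P := fun M => exists n (g : 'I_n -> Ed), generates g M /\ independent g)).
  exists 0%N, (fun=> 0); split; last by move=> c _ [].
  split=> // x ->; exists (fun=> 0); split; first by case.
  by rewrite big_ord0.
move=> {}M k hM MS [n [g [[gM gE] gI]]].
have [_ [m Mm <-] mE] := prS _ (coord_ideal k hM MS).
have [m0|m0] := eqVneq (m 0 k) 0.
  exists n, g; split=> //; split=> [i|x Mx]; first by have [] := gM i.
  apply: gE; split=> //.
  by have [|a _ ->] := mE (x 0 k); [exists x|rewrite m0 mulr0].
pose h (i : 'I_n.+1) := if unlift ord0 i is Some j then g j else m.
have hE (c : 'I_n.+1 -> E) :
    \sum_i c i *: h i = c ord0 *: m + \sum_i c (lift ord0 i) *: g i.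
  rewrite big_ord_recl /h unlift_none; congr (_ + _).
  by apply: eq_bigr => i _; rewrite liftK.
exists n.+1, h; split.
  split=> [i|x Mx]; first by rewrite /h; case: unliftP => // j _; have [] := gM j.
  have [|a aS aE] := mE (x 0 k); first by exists x.
  have [|c [cS cE]] := gE (x - a *: m).
    by split; [apply: submodB => //; apply: submodZ|rewrite !mxE aE subrr].
  exists (fun i => if unlift ord0 i is Some j then c j else a); split=> [i|].
    by case: unliftP.
  rewrite hE unlift_none; under eq_bigr do rewrite liftK.
  by rewrite -cE subrKC.
move=> c; rewrite hE => c0.
have cm : c ord0 = 0.
  have [y my] := Einv m0; rewrite -[c ord0]mulr1 -my mulrA.
  have /(congr1 (fun x : Ed => x 0 k)) := c0.
  rewrite !mxE summxE big1 ?addr0 => [->|i _]; first by rewrite mul0r.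
  by rewrite mxE (gM i).2 mulr0.
move: c0; rewrite cm scale0r add0r => /(gI (fun i => c (lift ord0 i))) cg i.
by case: (unliftP ord0 i) => [j ->|->].
Qed.

Lemma generates_span n (g : 'I_n -> Ed) M : submod M -> generates g M -> span (range g) = M.
Proof.
move=> hM [gM gE]; apply/seteqP; split; first by apply: span_min => // _ [i _ <-].
move=> x /gE[c [cS ->]]; apply: submod_sum; first exact: span_submod.
by move=> i; apply: (submodZ (span_submod _)) => //; apply: sub_span; exists i.
Qed.

Lemma submod_free M : principal_ideals S -> submod M ->
  (forall x, M x -> forall j, x 0 j \in S) -> is_free (M : set (restrict_scalars S Ed)).
Proof.
move=> prS hM MS; have [n [g [gM gI]]] := submod_basis prS hM MS.
exists (range g); split; last exact: (generates_span hM gM).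
move=> p b c b_inj bg bc.
(* An injective family in [range g] is re-indexed by an injection [s] into the indices of [g], so
   each fibre sum below has at most one term. *)
have [s sE] := choice (fun i => let: ex_intro2 j _ e := bg i in ex_intro _ j e).
have s_inj : injective s by move=> i j sij; apply: b_inj; rewrite -!sE sij.
have H : \sum_j (\sum_(i | s i == j) val (c i)) *: g j = 0.
  rewrite -[RHS]bc [RHS](partition_big s xpredT) //=; apply: eq_bigr => j _.
  by rewrite scaler_suml; apply: eq_bigr => i /eqP <-; rewrite sE.
move=> i; apply: val_inj; have := gI _ H (s i).
by rewrite (eq_bigl (pred1 i)) ?big_pred1_eq // => i'; rewrite inj_eq.
Qed.

End Submodules.

(** * Finite length and quasi-isomorphisms *)

Section FiniteLength.
Context (S : comNzRingType) (V : lmodType S).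
Implicit Types (F N : nat -> set V).

(* The levels at which a submodule meets F grow strictly along a strict chain. *)
Lemma finite_length_filtration n F : F 0%N `<=` [set 0] -> F n = setT ->
  (forall p, (p < n)%N -> forall x y, F p.+1 x -> F p.+1 y -> ~ F p y ->
     exists a, F p (x - a *: y)) ->
  finite_length V.
Proof.
move=> F0 Fn Fs; exists n => m N Nsub Nlt.
pose J i := [set p : 'I_n | `[< exists2 y, N i y & F p.+1 y /\ ~ F p y >]]%SET.
have JS i : (i < m)%N -> J i \proper J i.+1.
  move=> im; have [Nle Nne] := Nlt i im; apply/properP.
  have JJ : J i \subset J i.+1.
    apply/fintype.subsetP => p; rewrite !finset.in_set => /asboolP[y Ny yF].
    by apply/asboolP; exists y => //; apply: Nle.
  split=> //; apply: contrapT => noJ; apply: Nne.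
  have [_ NL] := Nsub i (ltnW im); have [_ NL'] := Nsub i.+1 im.
  suff H p : (p <= n)%N -> forall x, N i.+1 x -> F p x -> N i x.
    by move=> x Nx; apply: (H n) => //; rewrite Fn.
  elim: p => [|p IH] pn x Nx Fx.
    by rewrite (F0 x Fx); have [] := Nsub i (ltnW im).
  have [Fpx|Fpx] := pselect (F p x); first exact: IH (ltnW pn) _ Nx Fpx.
  have [y Ny [Fy nFy]] : exists2 y, N i y & F p.+1 y /\ ~ F p y.
    apply: contrapT => noy; apply: noJ; exists (Ordinal pn).
      by rewrite finset.in_set; apply/asboolP; exists x.
    by rewrite finset.in_set; apply/asboolP.
  have [a Fa] := Fs p pn x y Fx Fy nFy.
  rewrite -[x](subrKC (a *: y)); apply: NL => //.
  apply: IH Fa; first exact: ltnW.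
  by rewrite addrC -scaleNr; apply: NL' => //; apply: Nle.
have Ji i : (i <= m)%N -> (i <= #|J i|)%N.
  elim: i => [//|i IH] im; apply: leq_ltn_trans (IH (ltnW im)) _.
  exact: proper_card (JS i im).
by apply: leq_trans (Ji m (leqnn m)) _; rewrite -[X in (_ <= X)%N]card_ord max_card.
Qed.

(** Nakayama for one element: the chain of the multiples of [t ^+ k *: y] stops, which gives
    [t ^+ k *: y = (s * t) *: (t ^+ k *: y)], and [1 - s * t] is a unit. *)
Lemma finite_length_nilpotent (t : S) : finite_length V ->
  (forall s, exists r, r * (1 - s * t) = 1) -> forall y : V, exists k, t ^+ k *: y = 0.
Proof.
move=> [l H] tinv y.
(* The exponent runs backwards because [finite_length] bounds ascending chains; [l.+1] strict steps
   are one too many. *)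
pose N i : set V := [set s *: (t ^+ (l.+1 - i) *: y) | s in [set: S]].
have Nsub i : is_submodule (N i).
  split=> [|a _ _ [s _ <-] [s' _ <-]]; first by exists 0; rewrite ?scale0r.
  by exists (a * s + s') => //; rewrite scalerDl -scalerA.
have : ~ forall i, (i < l.+1)%N -> N i `<` N i.+1.
  by move=> /(H l.+1 N (fun i _ => Nsub i)); rewrite ltnn.
move=> /existsNP[i] /not_implyP[il] Ni; exists (l - i)%N.
have ls : (l.+1 - i = (l - i).+1)%N by lia.
have NN : N i `<=` N i.+1.
  move=> _ [s _ <-]; exists (s * t) => //.
  by rewrite subSS ls exprS -!scalerA.
have NN' : N i.+1 `<=` N i by apply: contrapT => nn; apply: Ni.
have [|s _ sE] := NN' (t ^+ (l - i) *: y); first by exists 1; rewrite ?scale1r.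
have [r rE] := tinv s.
rewrite -[LHS]scale1r -rE -scalerA scalerBl scale1r.
by rewrite -{1}sE ls exprS -!scalerA subrr scaler0.
Qed.

End FiniteLength.

Section Quotient.
Context (S : comNzRingType) (V : lmodType S) (W : set V) (hW : is_submodule W).

Lemma quotient_pi_eq0 (x : V) : (\pi_(quotient_module hW)%qT x = 0) <-> W x.
Proof.
split=> [|Wx].
  move/eqP; rewrite -[0](raddf0 (\pi_(quotient_module hW)%qT)).
  rewrite -[_ == _]Quotient.idealrBE subr0; exact: asboolW.
apply/eqP; rewrite -[0](raddf0 (\pi_(quotient_module hW)%qT)).
rewrite -[_ == _]Quotient.idealrBE subr0; exact/asboolP.
Qed.

Lemma quotient_pi_scale (a : S) (x : V) :
  a *: \pi_(quotient_module hW)%qT x = \pi_(quotient_module hW)%qT (a *: x).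
Proof. exact: quotient_scale_pi. Qed.

End Quotient.

(** * Flags with simple steps *)

Section Flags.
Context (E : comNzRingType) (S : subringClosed E) (d : nat).
Local Notation Ed := 'rV[E]_d.
Implicit Types (M N X Y Z : set Ed).

(** For submodules [Y] inside [Z], this says that [Z / Y] is zero or simple. *)
Definition flag_step Y Z : Prop := forall x y, Z x -> Z y -> ~ Y y ->
  exists2 a, a \in S & Y (x - a *: y).

(** The top level only has to contain [Z], so that a flag passes to smaller sets. *)
Definition flag X Z : Prop := exists n (F : nat -> set Ed),
  [/\ F 0%N = X, Z `<=` F n & forall p, (p < n)%N -> flag_step (F p) (F p.+1)].

Lemma flag_refl X : flag X X.
Proof. by exists 0%N, (fun=> X); split. Qed.

Lemma flag_sub X Z Z' : Z' `<=` Z -> flag X Z -> flag X Z'.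
Proof. by move=> ZZ [n [F [F0 FZ Fs]]]; exists n, F; split=> // x /ZZ/FZ. Qed.

Lemma flag_add X Z Z' : flag X Z -> flag_step Z Z' -> flag X Z'.
Proof.
move=> [n [F [F0 FZ Fs]]] ZZ.
exists n.+1, (fun p => if (p <= n)%N then F p else Z'); split=> //.
  by rewrite ltnn.
move=> p pn1; have [pn|np] := ltnP p n; first by rewrite (ltnW pn); exact: Fs.
have -> : p = n by lia.
rewrite leqnn => x y Zx Zy Fy; have [|a aS aZ] := ZZ x y Zx Zy; first by move=> /FZ.
by exists a => //; apply: FZ.
Qed.

Context (M N : set Ed) (hM : submod S M) (hN : submod S N).

Lemma submodule_memP (x : submodule_type hM) : M (val x).
Proof. exact: asboolW (valP x). Qed.

(** The image of the flag in the cokernel is a filtration as in [finite_length_filtration]; its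
    bottom level [M] becomes 0 because [f] is the inclusion. *)
Lemma submodule_type_finite_length_coker (f : {linear submodule_type hM -> submodule_type hN}) :
  (forall x, val (f x) = val x :> Ed) -> flag M N -> finite_length (cokernel f).
Proof.
move=> fE [n [F [F0 FZ Fs]]].
pose Q := cokernel f.
pose q : submodule_type hN -> Q := fun x => \pi_(quotient_module (range_is_submodule f))%qT x.
apply: (@finite_length_filtration _ Q n 
  (fun p => [set q x | x in [set x : submodule_type hN | F p (val x)]])).
- move=> _ [x Fx <-]; apply/quotient_pi_eq0; rewrite F0 /= in Fx.
  have xM : (val x : restrict_scalars S Ed) \in submodule_pred hM by apply/asboolP.
  by exists (Sub (val x) xM) => //; apply: val_inj; rewrite fE.
- apply/seteqP; split=> // y _; exists (repr y); last exact: reprK.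
  by apply: FZ; exact: asboolW (valP (repr y)).
move=> p pn _ _ [x Fx <-] [y Fy <-] nFy.
have [|a aS aF] := Fs p pn _ _ Fx Fy; first by move=> Fpy; apply: nFy; exists y.
exists (Sub a aS : subring_type S).
exists (x - (Sub a aS : subring_type S) *: y); first exact: aF.
by rewrite /q quotient_pi_scale raddfB.
Qed.

End Flags.

(** * Submodules of E^d as abstract modules *)

Section SubmoduleTypes.
Context (E : comNzRingType) (S : subringClosed E) (d : nat).
Local Notation Ed := 'rV[E]_d.
Implicit Types (M N : set Ed).

Lemma submodule_fgP M (hM : submod S M) : finitely_generated (submodule_type hM) <->
  exists n (g : 'I_n -> Ed), generates S g M.
Proof.
split=> [[n [g gE]]|[n [g [gM gE]]]].
  exists n, (fun i => val (g i)); split=> [i|x Mx]; first exact: submodule_memP.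
  have xM : (x : restrict_scalars S Ed) \in submodule_pred hM by apply/asboolP.
  pose z : submodule_type hM := Sub (x : restrict_scalars S Ed) xM.
  have [c cE] := gE z.
  exists (fun i => val (c i)); split=> [i|]; first exact: valP.
  have zE : x = val (\sum_i c i *: g i) by rewrite -cE.
  by rewrite zE raddf_sum.
have gM' i : (g i : restrict_scalars S Ed) \in submodule_pred hM by apply/asboolP.
exists n, (fun i => Sub (g i : restrict_scalars S Ed) (gM' i)) => x.
pose y : Ed := val x; have My : M y := submodule_memP x.
have [c [cS cE]] := gE y My.
pose c' i : subring_type S := Sub (c i) (cS i).
exists c'; apply: val_inj; rewrite raddf_sum.
exact: cE.
Qed.

Lemma submodule_torsion_free M (hM : submod S M) :
  (forall x : E, x != 0 -> exists y, x * y = 1) -> torsion_free (submodule_type hM).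
Proof.
move=> Einv a x ax0; have [->|a0] := eqVneq a 0; [by left|right].
have va0 : val a != 0 by apply: contra_neq a0 => a0; apply: val_inj.
have [b ab] := Einv _ va0; apply: val_inj.
have : val a *: (val x : Ed) = 0 := congr1 val ax0.
by move/(congr1 (fun z => b *: z)); rewrite scalerA mulrC ab scale1r scaler0.
Qed.

Lemma submodule_valZX M (hM : submod S M) (a : subring_type S) k (x : submodule_type hM) :
  val (a ^+ k *: x) = val a ^+ k *: (val x : Ed) :> Ed.
Proof. by rewrite -rmorphXn. Qed.

Context (M N : set Ed) (hM : submod S M) (hN : submod S N) (MN : M `<=` N).

Lemma submodule_incl_mem (x : submodule_type hM) :
  (val x : restrict_scalars S Ed) \in submodule_pred hN.
Proof. by apply/asboolP; apply: MN; exact: submodule_memP. Qed.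

Definition submodule_incl (x : submodule_type hM) : submodule_type hN :=
  Sub (val x : restrict_scalars S Ed) (submodule_incl_mem x).

Lemma submodule_incl_linear : linear submodule_incl.
Proof. by move=> a x y; apply: val_inj. Qed.

HB.instance Definition _ := GRing.isLinear.Build (subring_type S) (submodule_type hM)
  (submodule_type hN) _ submodule_incl submodule_incl_linear.

End SubmoduleTypes.

Lemma torsion_free_cancel (S : comNzRingType) (V : lmodType S) (t : S) k (x : V) :
  torsion_free V -> t != 0 -> t ^+ k *: x = 0 -> x = 0.
Proof.
move=> tfV t0; elim: k => [|k IH]; first by rewrite expr0 scale1r.
by rewrite exprS -scalerA => /tfV[/eqP|//]; rewrite (negPf t0).
Qed.

(** * Quasi-isomorphisms out of torsion-free modules *)

Section Bijections.
Context (S : comNzRingType) (V W : lmodType S) (f : {linear V -> W}).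

Lemma injective_kernel_finite_length : (forall x, f x = 0 -> x = 0) -> finite_length (kernel f).
Proof.
move=> f_inj; apply: (@finite_length_filtration _ _ 0 (fun=> setT)) => // x _.
by apply: val_inj; apply: f_inj; exact: asboolW (valP x).
Qed.

Lemma bijective_linear_inverse : (forall x, f x = 0 -> x = 0) -> (forall y, exists x, f x = y) ->
  exists g : {linear W -> V}, forall x, g (f x) = x.
Proof.
move=> f_inj f_surj; have [g gE] := choice f_surj.
have inj x y : f x = f y -> x = y.
  by move=> xy; apply/subr0_eq/f_inj; rewrite linearB /= xy subrr.
have glin : linear g by move=> a x y; apply: inj; rewrite linearP !gE.
pose G := GRing.isLinear.Build _ _ _ _ g glin.
pose gL : {linear W -> V} := HB.pack g G.
by exists gL => x; apply: inj; rewrite /= gE.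
Qed.

(** [t] acts nilpotently on each element of the kernel and the cokernel; torsion-freeness of [V]
    then kills the kernel. *)
Lemma quasi_isomorphism_nilpotent (t : S) : torsion_free V -> quasi_isomorphism f ->
  t != 0 -> (forall s, exists r, r * (1 - s * t) = 1) ->
  (forall x, f x = 0 -> x = 0) /\ forall y, exists k x, f x = t ^+ k *: y.
Proof.
move=> tfV [fker fcok] t0 tinv; split=> [x fx|y].
  have xk : x \in submodule_pred (ker_is_submodule f) by apply/asboolP.
  have [k kx] := finite_length_nilpotent fker tinv (Sub x xk).
  by apply: (torsion_free_cancel (k := k) tfV t0); exact: (congr1 val kx).
have [k] := finite_length_nilpotent fcok tinv (\pi_(quotient_module (range_is_submodule f))%qT y).
by rewrite quotient_pi_scale => /quotient_pi_eq0[x _ fx]; exists k, x.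
Qed.

Lemma linear_preimage (t : S) k (x z : V) (y : W) : torsion_free W -> t != 0 ->
  f x = t ^+ k *: y -> t ^+ k *: z = x -> f z = y.
Proof.
move=> tfW t0 fx zx; apply/subr0_eq/(torsion_free_cancel (k := k) tfW t0).
by rewrite scalerBr -fx -zx linearZ subrr.
Qed.

(** Both sides map to [(a * b) *: y]. *)
Lemma linear_preimage_comm (a b : S) (x x' : V) (y : W) : (forall z, f z = 0 -> z = 0) ->
  f x = a *: y -> f x' = b *: y -> b *: x = a *: x'.
Proof.
move=> f_inj fx fx'; apply/subr0_eq/f_inj; rewrite linearB !linearZ /=.
by rewrite fx fx' ?scalerN !scalerA mulrC subrr.
Qed.

End Bijections.

(** * Clearing denominators *)

Section Denominators.
Context (E : comNzRingType) (S : subringClosed E) (d : nat) (t : E).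
Local Notation Ed := 'rV[E]_d.

Lemma denominators_closed (Y : set Ed) a x y : t \in S -> submod S Y ->
  (exists k, t ^+ k * a \in S) -> (exists k, Y (t ^+ k *: x)) -> (exists k, Y (t ^+ k *: y)) ->
  exists k, Y (t ^+ k *: (a *: x + y)).
Proof.
move=> tS hY [k1 ka] [k2 kx] [k3 ky]; exists (k1 + k2 + k3)%N.
have -> : t ^+ (k1 + k2 + k3) *: (a *: x + y) =
    (t ^+ k3 * (t ^+ k1 * a)) *: (t ^+ k2 *: x) + t ^+ (k1 + k2) *: (t ^+ k3 *: y).
  rewrite scalerDr !scalerA !exprD; congr (_ *: _ + _); ring.
have tkS k : t ^+ k \in S by apply: rpredX.
by apply: (submodD hY); apply: (submodZ hY) => //; apply: rpredM.
Qed.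

End Denominators.

(** Linear closure of the approximation property in [pair_span_Su]. In [e *: x] the main term is
    [e' *: z]; both errors are divisible by [p ^+ c], with [k1] and [k2] clearing the denominators
    of [e] and [z]. *)
Lemma density_identity (E : comNzRingType) (V : lmodType E) (w p e e' e'' : E) (x x' y y' z : V)
    (c k1 k2 l1 l2 l3 : nat) :
  e = e' + p ^+ (c + k2) * e'' -> x = z + p ^+ (c + k1) *: y ->
  w ^+ (l1 + l2 + l3) *:
    (e *: x + x' - p ^+ c *: ((p ^+ k1 * e) *: y + e'' *: (p ^+ k2 *: z) + y')) =
  w ^+ l2 *: ((w ^+ l3 * e') *: (w ^+ l1 *: z)) +
  w ^+ (l1 + l3) *: (w ^+ l2 *: (x' - p ^+ c *: y')).
Proof.
move=> eE xE.
have -> : e *: x + x' - p ^+ c *: ((p ^+ k1 * e) *: y + e'' *: (p ^+ k2 *: z) + y') =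
    e' *: z + (x' - p ^+ c *: y').
  have ex : e *: x = e' *: z + p ^+ c *: ((p ^+ k1 * e) *: y + e'' *: (p ^+ k2 *: z)).
    rewrite xE !scalerDr !scalerA {1}eE scalerDl -addrA; congr (_ + _); rewrite addrC.
    by congr (_ *: _ + _ *: _); rewrite exprD; ring.
  by rewrite ex [p ^+ c *: (_ + y')]scalerDr opprD addrACA addrK.
by rewrite scalerDr !scalerA; congr (_ *: _ + _ *: _); rewrite !exprD; ring.
Qed.

(** Linear closure of the decomposition used in [span_Su_wX]: only the part [a'] of [a] multiplies
    the numerator [m], and everything else goes into the multiple of [q]. *)
Lemma numerator_identity (E : comNzRingType) (V : lmodType E) (w q a a' a'' : E)
    (x x' m m' y y' : V) (l1 l2 l3 : nat) :
  a = a' + q * a'' -> w ^+ l1 *: x = m + q *: y -> w ^+ l2 *: x' = m' + q *: y' ->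
  w ^+ (l1 + l2 + l3) *: (a *: x + x') =
  w ^+ l2 *: ((w ^+ l3 * a') *: m) + w ^+ (l1 + l3) *: m' +
  q *: ((w ^+ (l2 + l3) * a'') *: m + (w ^+ (l2 + l3) * a) *: y + w ^+ (l1 + l3) *: y').
Proof.
move=> aE xE xE'.
have -> : w ^+ (l1 + l2 + l3) *: (a *: x + x') =
    (w ^+ (l2 + l3) * a) *: (w ^+ l1 *: x) + w ^+ (l1 + l3) *: (w ^+ l2 *: x').
  by rewrite scalerDr !scalerA; congr (_ *: _ + _ *: _); rewrite !exprD; ring.
rewrite xE xE' !scalerDr !scalerA !addrA; congr (_ + _); last by congr (_ *: _); ring.
rewrite [LHS]addrAC; congr (_ + _); last by congr (_ *: _); ring.
rewrite [RHS]addrAC; congr (_ + _).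
by rewrite {1}aE -scalerDl; congr (_ *: _); rewrite !exprD; ring.
Qed.

(** * Denominators *)

Section Denominator.
Context (R : idomainType) (pi : R) (v : {fraction R} -> int).
Context (D : complete_dvr pi v) (nu : rat).
Local Notation E := (calE D nu).
Local Notation al := (denq nu).
Local Notation be := (numq nu).
Local Notation S := (Snu D nu).
Local Notation Spi := (Spi D nu).
Local Notation Su := (Su D nu).
Implicit Types (e f g h : E).

Definition pi_cst : E := mono D nu pi%:F 0.
Definition pi_cstV : E := mono D nu pi%:F^-1 0.
(* w = u^alpha / pi^beta has Gauss valuation 0 *)
Definition w_mon : E := mono D nu (pi%:F ^ (- be)) al.
Definition w_monV : E := mono D nu (pi%:F ^ be) (- al).

Lemma al_gt0 : 0 < al. Proof. exact: denq_gt0. Qed.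

Lemma pi_cstVr : pi_cst * pi_cstV = 1.
Proof. by rewrite /pi_cst /pi_cstV monoM divff ?(pi_neq0 D) // addr0 mono10. Qed.

Lemma w_monVr : w_mon * w_monV = 1.
Proof. by rewrite /w_mon /w_monV monoM -expfzDr ?(pi_neq0 D) // addNr expr0z subrr mono10. Qed.

Lemma pX_pVX k : pi_cst ^+ k * pi_cstV ^+ k = 1.
Proof. by rewrite -exprMn pi_cstVr expr1n. Qed.

Lemma wX_wVX k : w_mon ^+ k * w_monV ^+ k = 1.
Proof. by rewrite -exprMn w_monVr expr1n. Qed.

Lemma p_ige : ige pi_cst al.
Proof.
by apply: mono_ige; apply/orP; right; rewrite (valuation_uniformizer D); lia.
Qed.

Lemma pV_ige : ige pi_cstV (- al).
Proof.
apply: mono_ige; apply/orP; right.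
by rewrite (vV D) ?(pi_neq0 D) // (valuation_uniformizer D); lia.
Qed.

Lemma pVX_ige k : ige (pi_cstV ^+ k) (- al * k%:Z).
Proof.
elim: k => [|k IH]; first by rewrite mulr0; apply: ige1.
by rewrite exprS intS mulrDr mulr1; apply: igeM => //; apply: pV_ige.
Qed.

Lemma w_ige : ige w_mon 0.
Proof. by apply: mono_ige; apply/orP; right; rewrite (v_expz D); lia. Qed.

Lemma wV_ige : ige w_monV 0.
Proof. by apply: mono_ige; apply/orP; right; rewrite (v_expz D); lia. Qed.

Lemma wX_ord k : ord_ge (w_mon ^+ k) (al * k%:Z).
Proof.
elim: k => [|k IH]; first by rewrite mulr0; apply: ord_ge1.
by rewrite exprS intS mulrDr mulr1; apply: ord_geM => //; apply: ord_ge_mono.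
Qed.

Lemma wVX_ord k : ord_ge (w_monV ^+ k) (- al * k%:Z).
Proof.
elim: k => [|k IH]; first by rewrite mulr0; apply: ord_ge1.
by rewrite exprS intS mulrDr mulr1; apply: ord_geM => //; apply: ord_ge_mono.
Qed.

Lemma Snu_Spi f : f \in S -> f \in Spi. Proof. by case/SnuP. Qed.
Lemma Snu_Su f : f \in S -> f \in Su. Proof. by case/SnuP. Qed.

Lemma p_Snu : pi_cst \in S.
Proof.
apply/SnuP; split; first by apply/SpiP; apply: ord_ge_mono.
by apply/SuP; apply: igeW p_ige; have := al_gt0; lia.
Qed.

Lemma w_Snu : w_mon \in S.
Proof.
apply/SnuP; split; last by apply/SuP; apply: w_ige.
by apply/SpiP; apply: (@ord_geW _ _ _ _ _ _ al); [exact: ltW al_gt0|exact: ord_ge_mono].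
Qed.

Lemma pV_Spi : pi_cstV \in Spi. Proof. by apply/SpiP; apply: ord_ge_mono. Qed.
Lemma wV_Su : w_monV \in Su. Proof. by apply/SuP; apply: wV_ige. Qed.

(** Each factor pi adds [al >= 1] to the weight. *)
Lemma exists_pX_Su e : exists k, pi_cst ^+ k * e \in Su.
Proof.
have [m em] := ige_has e; exists (absz m).
apply/SuP; apply: (@igeW _ _ _ _ _ _ (al * `|m|%N%:Z + m)).
  by have := al_gt0; nia.
apply: igeM => //; elim: `|m|%N => [|k IH]; first by rewrite mulr0; apply: ige1.
by rewrite exprS intS mulrDr mulr1; apply: igeM => //; apply: p_ige.
Qed.

Lemma exists_pX_Snu e : e \in Spi -> exists k, pi_cst ^+ k * e \in S.
Proof.
move=> eS; have [k ke] := exists_pX_Su e; exists k; apply/SnuP; split=> //.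
by apply: rpredM => //; apply: rpredX; apply: Snu_Spi p_Snu.
Qed.

(* S_nu[1/w] is dense in S_(nu,u), and S_(nu,pi)[1/w] is dense in E *)
Lemma approx_wX e C : exists l e' e'', [/\ e = e' + pi_cst ^+ C * e'', w_mon ^+ l * e' \in Spi,
  e'' \in Su & (e \in Su -> w_mon ^+ l * e' \in S)].
Proof.
have [N eN] := ninfty_wge e (al * C%:Z).
have oS : w_mon ^+ (absz (N + 1)) * hi (N + 1) e \in Spi.
  apply/SpiP; apply: (@ord_geW _ _ _ _ _ _ (al * (absz (N + 1))%:Z + (N + 1))).
    by have := al_gt0; nia.
  by apply: ord_geM; [exact: wX_ord|exact: ord_ge_hi].
exists (absz (N + 1)), (hi (N + 1) e), (pi_cstV ^+ C * (e - hi (N + 1) e)); split=> //.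
- by rewrite mulrA pX_pVX mul1r addrC subrK.
- apply/SuP; rewrite -[0](addNr (al * C%:Z)) -mulNr; apply: igeM; first exact: pVX_ige.
  move=> i; rewrite Defs.coefB coef_hi; case: leP => iN; first by rewrite subrr wge0.
  by rewrite subr0; apply: eN; lia.
- move=> /SuP e0; apply/SnuP; split=> //; apply: rpredM.
    by apply: rpredX; apply: Snu_Su w_Snu.
  by apply/SuP; apply: hi_ige.
Qed.

(** pi lies in the radical because it raises the weight; this supplies the units asked for by
    [finite_length_nilpotent]. *)
Lemma one_sub_mul_p_inv f : f \in S -> exists2 r, r \in S & r * (1 - f * pi_cst) = 1.
Proof.
move=> /SnuP[/SpiP f0 /SuP fw].
have h1 : ige (- (f * pi_cst)) 1.
  by apply: igeN; apply: (@igeW _ _ _ _ _ _ (0 + al)); [have := al_gt0; lia|apply: igeM p_ige].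
have [q [qE q0 qo]] := one_add_inv h1; exists q; last by rewrite mulrC.
apply/SnuP; split; [apply/SpiP|exact/SuP]; apply: qo.
by apply: ord_geN; rewrite -[0]addr0; apply: ord_geM => //; apply: ord_ge_mono.
Qed.

(** [w_mon] has weight 0 but raises the order by [al], so the u-adic geometric series applies. *)
Lemma one_sub_mul_w_inv f : f \in S -> exists2 r, r \in S & r * (1 - f * w_mon) = 1.
Proof.
move=> fS; have fwS : f * w_mon \in S by apply: rpredM => //; exact: w_Snu.
have [|q qS qE] := one_sub_inv fwS; last by exists q => //; rewrite mulrC.
have /SnuP[/SpiP f0 _] := fS.
apply: (@ord_geW _ _ _ _ _ _ (0 + al)); first by have := al_gt0; lia.
by apply: ord_geM => //; apply: ord_ge_mono.
Qed.

End Denominator.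

(** * Maximal modules and pairs of free modules *)

Section Lattices.
Context (R : idomainType) (pi : R) (v : {fraction R} -> int).
Context (D : complete_dvr pi v) (nu : rat) (d : nat).
Local Notation E := (calE D nu).
Local Notation Ed := 'rV[E]_d.
Local Notation al := (denq nu).
Local Notation S := (Snu D nu).
Local Notation Spi := (Spi D nu).
Local Notation Su := (Su D nu).
Local Notation p := (pi_cst D nu).
Local Notation pV := (pi_cstV D nu).
Local Notation w := (w_mon D nu).
Local Notation wV := (w_monV D nu).
Implicit Types (e f : E) (M N A B X Y : set Ed).

Lemma submod_Spi_Snu A : submod Spi A -> submod S A.
Proof.
by move=> /submodP[A0 AL]; apply/submodP; split=> // a x y /Snu_Spi; apply: AL.
Qed.

Lemma submod_Su_Snu A : submod Su A -> submod S A.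
Proof.
by move=> /submodP[A0 AL]; apply/submodP; split=> // a x y /Snu_Su; apply: AL.
Qed.

Lemma submodI A B : submod S A -> submod S B -> submod S (A `&` B).
Proof.
move=> hA hB; apply/submodP; split; first by split; apply: submod0; eassumption.
move=> a x y aS [Ax Bx] [Ay By].
by split; [apply: (submodD hA) => //; apply: (submodZ hA)
          |apply: (submodD hB) => //; apply: (submodZ hB)].
Qed.

(** E is [Su] with pi inverted. *)
Lemma Espan_pX X Y : submod Su Y -> X `<=` Y ->
  submodule_span X `<=` [set x | exists k, Y (p ^+ k *: x)].
Proof.
move=> hY XY x /(_ [set x | exists k, Y (p ^+ k *: x)]); apply; split; last first.
  by move=> z /XY Yz; exists 0%N; rewrite expr0 scale1r.
split=> [|a z z' kz kz']; first by exists 0%N; rewrite scaler0; apply: submod0 hY.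
apply: (denominators_closed _ hY _ kz kz'); first by apply: Snu_Su; apply: p_Snu.
exact: exists_pX_Su.
Qed.

Lemma span_Spi_pX M : submod S M -> span Spi M `<=` [set x | exists k, M (p ^+ k *: x)].
Proof.
move=> hM; apply: span_min => [|z Mz]; last by exists 0%N; rewrite expr0 scale1r.
apply/submodP; split=> [|a z z' aS kz kz']; first by exists 0%N; rewrite scaler0; apply: submod0 hM.
by apply: (denominators_closed _ hM _ kz kz'); [apply: p_Snu|apply: exists_pX_Snu].
Qed.

Lemma pVX_Spi A k x : submod Spi A -> A (p ^+ k *: x) -> A x.
Proof.
move=> hA Ax; rewrite -[x]scale1r -(pX_pVX D nu k) mulrC -scalerA.
by apply: (submodZ hA) => //; apply: rpredX; apply: pV_Spi.
Qed.

Lemma wVX_Su B k x : submod Su B -> B (w ^+ k *: x) -> B x.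
Proof.
move=> hB Bx; rewrite -[x]scale1r -(wX_wVX D nu k) mulrC -scalerA.
by apply: (submodZ hB) => //; apply: rpredX; apply: wV_Su.
Qed.

Lemma pX_cancel k (x : Ed) : p ^+ k *: x = 0 -> x = 0.
Proof. by move=> px; rewrite -[x]scale1r -(pX_pVX D nu k) mulrC -scalerA px scaler0. Qed.

Lemma submod_pX M k l x : submod S M -> (k <= l)%N -> M (p ^+ k *: x) -> M (p ^+ l *: x).
Proof.
move=> hM kl Mx; rewrite -(subnK kl) exprD -scalerA; apply: (submodZ hM) => //.
by apply: rpredX; apply: p_Snu.
Qed.

(** * Adjoining one generator by simple steps *)

Section FlagStep.
Context (X0 X : set Ed) (hX : submod S X) (g : Ed) (k l : nat).
Context (pg : X (p ^+ k *: g)) (wg : X (w ^+ l *: g)).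

(** A filtration between [X] and [X + S g] by the multiplier of [g]: first by its order [i], then by
    the weight of its coefficient at [i], in blocks of length [al]. *)
Let G (i t : nat) : set Ed := [set x | exists f,
  [/\ f \in S, X (x - f *: g), ord_ge f i%:Z & wge v nu (coef f i%:Z) i%:Z (al * t%:Z)]].

(** A multiplier of order at least [al * l] is divisible by [w ^+ l] in [S]. *)
Let G_top : G (absz (al * l%:Z)) 0 `<=` X.
Proof.
move=> x [f [fS Xx fo _]].
have -> : x = (x - f *: g) + (f * wV ^+ l) *: (w ^+ l *: g).
  by rewrite scalerA -mulrA [_ ^+ l * _]mulrC wX_wVX mulr1 subrK.
apply: (submodD hX) => //; apply: (submodZ hX) => //.
apply/SnuP; split.
  apply/SpiP; apply: (@ord_geW _ _ _ _ _ _ ((absz (al * l%:Z))%:Z + (- al * l%:Z))).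
    by have := al_gt0 nu; nia.
  by apply: ord_geM => //; apply: wVX_ord.
by apply: rpredM; [apply: Snu_Su|apply: rpredX; apply: wV_Su].
Qed.

(** A lowest monomial of weight at least [al * k] is divisible by [p ^+ k], so it can be moved into
    [X]. *)
Let G_bottom i : G i k `<=` G i.+1 0.
Proof.
move=> x [f [fS Xx fo fk]]; pose c := coef f i%:Z.
have /SnuP[/SpiP f0 /SuP fw] := fS.
have mS : mono D nu c i%:Z \in S.
  by apply/SnuP; split; [apply/SpiP => j j0; rewrite coef_mono; case: eqP => // ji; lia
                        |apply/SuP/mono_ige/fw].
have fmS : f - mono D nu c i%:Z \in S by apply: rpredB.
have /SnuP[_ /SuP fmw] := fmS.
exists (f - mono D nu c i%:Z); split=> //; last by rewrite mulr0.
  have -> : x - (f - mono D nu c i%:Z) *: g =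
      (x - f *: g) + (pV ^+ k * mono D nu c i%:Z) *: (p ^+ k *: g).
    rewrite scalerA mulrAC [pV ^+ k * _]mulrC pX_pVX mul1r scalerBl.
    by rewrite opprB addrA addrAC.
  apply: (submodD hX) => //; apply: (submodZ hX) => //; apply/SnuP; split.
    by apply: rpredM; [apply: rpredX; apply: pV_Spi|apply: Snu_Spi].
  apply/SuP; rewrite -[0](addNr (al * k%:Z)) -mulNr.
  by apply: igeM; [exact: pVX_ige|apply: mono_ige].
move=> j ji; rewrite Defs.coefB coef_mono; have [->|jne] := eqVneq j i%:Z.
  by rewrite subrr.
by rewrite subr0; apply: fo; lia.
Qed.

(** Weights at a fixed exponent are congruent modulo [al], so each block holds a single valuation
    and its quotient is at most one copy of the residue field. *)
Let G_step i t : flag_step S (G i t.+1) (G i t).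
Proof.
move=> x y [f [fS Xx fo ft]] [f' [fS' Xy fo' ft']] nGy.
have : ~~ wge v nu (coef f' i%:Z) i%:Z (al * t.+1%:Z).
  by apply/negP => ft''; apply: nGy; exists f'.
rewrite /wge negb_or => /andP[f'0 f't].
pose r := coef f i%:Z / coef f' i%:Z; pose a := mono D nu r 0.
have aS : a \in S.
  apply/SnuP; split; first by apply/SpiP; apply: ord_ge_mono.
  apply/SuP; apply: mono_ige; rewrite /wge; have [//|r0] := eqVneq r 0.
  have f0 : coef f i%:Z != 0 by apply: contra_neq r0 => f0; rewrite /r f0 mul0r.
  move: ft f't; rewrite /wge (negPf f0) /= -ltNge => ft f't.
  rewrite /r (valuationM D) ?invr_eq0 // (vV D) // mulr0 addr0.
  (* The valuation of the ratio is an integer greater than -1. *)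
  apply: mulr_ge0; [exact: ltW (al_gt0 nu)|rewrite subr_ge0 -ltzD1 -(ltr_pM2l (al_gt0 nu))].
  by move: ft f't; rewrite intS !mulrDr !mulr1; lia.
exists a => //; exists (f - a * f'); split.
- by apply: rpredB => //; apply: rpredM.
- have -> : x - a *: y - (f - a * f') *: g = (x - f *: g) - a *: (y - f' *: g).
    by rewrite scalerBl scalerBr scalerA !opprB addrACA [in RHS]addrACA; congr (_ + _); rewrite addrC.
  by apply: (submodB hX) => //; apply: (submodZ hX).
- apply: ord_geB => //; rewrite -[i%:Z]add0r; apply: ord_geM => //; exact: ord_ge_mono.
- by rewrite Defs.coefB coef_monoM subr0 divfK // subrr wge0.
Qed.

Lemma flag_generator : flag S X0 X ->
  exists Y, [/\ submod S Y, X `<=` Y, Y g & flag S X0 Y].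
Proof.
move=> FX; exists [set x | exists2 f, f \in S & X (x - f *: g)]; split.
- apply/submodP; split; first by exists 0; [exact: rpred0|rewrite scale0r subr0; apply: submod0 hX].
  move=> a x y aS [f fS Xx] [f' fS' Xy]; exists (a * f + f').
    by apply: rpredD => //; apply: rpredM.
  have -> : a *: x + y - (a * f + f') *: g = a *: (x - f *: g) + (y - f' *: g).
    by rewrite scalerDl scalerBr scalerA opprD addrACA.
  by apply: (submodD hX) => //; apply: (submodZ hX).
- by move=> x Xx; exists 0; [exact: rpred0|rewrite scale0r subr0].
- by exists 1; [exact: rpred1|rewrite scale1r subrr; apply: submod0 hX].
(* [G i k] lies inside [G i.+1 0], and [k] simple steps lead from it up to [G i 0]. *)
have descend i : flag S X0 (G i.+1 0) -> flag S X0 (G i 0).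
  move=> Fi; have Fk : flag S X0 (G i k) by apply: flag_sub Fi; apply: G_bottom.
  suff H s : (s <= k)%N -> flag S X0 (G i (k - s)) by have := H k (leqnn k); rewrite subnn.
  elim: s => [|s IH] sk; first by rewrite subn0.
  have ks : (k - s)%N = (k - s.+1).+1 by lia.
  by apply: flag_add (IH (ltnW sk)) _; rewrite ks; apply: G_step.
pose L := (absz (al * l%:Z)).
have top : flag S X0 (G L 0) by apply: flag_sub FX; apply: G_top.
have H i : (i <= L)%N -> flag S X0 (G (L - i) 0).
  elim: i => [|i IH] iL; first by rewrite subn0.
  by apply: descend; have <- : (L - i)%N = (L - i.+1).+1 by [lia|]; apply: IH; apply: ltnW.
have := H L (leqnn L); rewrite subnn; apply: flag_sub => x [f fS Xx].
have /SnuP[/SpiP f0 /SuP fw] := fS.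
by exists f; split=> //; rewrite mulr0.
Qed.

End FlagStep.

(** The generators are adjoined one at a time; multiples that lie in [M] also lie in every larger
    stage. *)
Lemma flag_generators M N n (g : 'I_n -> Ed) : submod S M -> generates S g N ->
  (forall i, exists k, M (p ^+ k *: g i)) -> (forall i, exists l, M (w ^+ l *: g i)) ->
  flag S M N.
Proof.
move=> hM [gN gE] pg wg.
have H i : (i <= n)%N -> exists X, [/\ submod S X, M `<=` X, flag S M X &
    forall j : 'I_n, (j < i)%N -> X (g j)].
  elim: i => [|i IH] i_n; first by exists M; split=> //; exact: flag_refl.
  have [X [hX MX FX Xg]] := IH (ltnW i_n); pose j0 := Ordinal i_n.
  have [k kg] := pg j0; have [l lg] := wg j0.
  have [Y [hY XY Yg FY]] := flag_generator hX (MX _ kg) (MX _ lg) FX.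
  exists Y; split=> // [x /MX/XY//|j ji].
  have [->//|jj] := eqVneq j j0; apply/XY/Xg; move: jj ji; rewrite -val_eqE /=; lia.
have [X [hX MX FX Xg]] := H n (leqnn n).
apply: flag_sub FX => x /gE[c [cS ->]].
by apply: (submod_sum hX) => i; apply: (submodZ hX) => //; apply: Xg.
Qed.

(** * Intersections of pairs spanning the same space *)

Section Pair.
Context (A B : set Ed) (hA : submod Spi A) (hB : submod Su B).
Context (A_rows : A `<=` rows_in Spi) (B_rows : B `<=` rows_in Su).
Context (AB_span : submodule_span A = submodule_span B).

Let A_Espan : A `<=` submodule_span B.
Proof. by rewrite -AB_span => x Ax Z [_]; apply. Qed.

Let B_Espan : B `<=` submodule_span A.
Proof. by rewrite AB_span => x Ax Z [_]; apply. Qed.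

Lemma pair_submod : submod S (A `&` B).
Proof. by apply: submodI; [apply: submod_Spi_Snu|apply: submod_Su_Snu]. Qed.

Lemma pair_rows : A `&` B `<=` rows_in S.
Proof. by move=> x [/A_rows Ax /B_rows Bx] j; apply/SnuP. Qed.

Lemma pair_fg : exists n (g : 'I_n -> Ed), generates S g (A `&` B).
Proof.
apply: submod_fg; [exact: Snu_fg|exact: pair_submod|exact: pair_rows].
Qed.

(** A power of [p] moves an element of [A] into [B], and [p] is a unit of [Spi]. *)
Lemma pair_span_Spi : span Spi (A `&` B) = A.
Proof.
apply/seteqP; split; first by apply: span_min => // x [].
move=> x Ax; have [k Bx] := Espan_pX hB (@subset_refl _ B) (A_Espan Ax).
apply: (pVX_Spi (k := k) (span_submod Spi _)).
apply: sub_span; split=> //; apply: (submodZ hA) => //.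
by apply: rpredX; apply: Snu_Spi; apply: p_Snu.
Qed.

(** [B] is finitely generated, so the largest exponent among its generators serves for all of it. *)
Let bounded_denominator : exists c, forall y, B y -> span Su (A `&` B) (p ^+ c *: y).
Proof.
have hN := span_submod Su (A `&` B).
have [n [b [bB bE]]] := submod_fg (principal_fg (@Su_principal _ _ _ D nu)) hB B_rows.
have kb i : exists k, span Su (A `&` B) (p ^+ k *: b i).
  have : submodule_span (A `&` B) (b i).
    move=> Z hZ; apply: (B_Espan (bB i)); split; first by case: hZ.
    have hZ' : submod Spi Z.
      by case: hZ => -[Z0 ZL] _; apply/submodP; split=> // a x y _; apply: ZL.
    by rewrite -pair_span_Spi; apply: span_min => //; case: hZ.
  by apply: Espan_pX hN (@sub_span _ _ _ _) _.
have [k kE] := choice kb; exists (\max_i k i) => y /bE[c [cS ->]].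
rewrite scaler_sumr; apply: (submod_sum hN) => i.
rewrite scalerA mulrC -scalerA; apply: (submodZ hN) => //.
rewrite -(subnK (leq_bigmax i)) exprD -scalerA; apply: (submodZ hN) => //.
by apply: rpredX; apply: Snu_Su; apply: p_Snu.
Qed.

(* Density: b = p^c y + x with y in B and w^l x in A, so that w^l x lies in the intersection. *)
Lemma pair_span_Su : span Su (A `&` B) = B.
Proof.
have hN := span_submod Su (A `&` B).
apply/seteqP; split; first by apply: span_min => // x [].
have [c cE] := bounded_denominator.
have wlA l x : A x -> A (w ^+ l *: x).
  by move=> Ax; apply: (submodZ hA) => //; apply: rpredX; apply: Snu_Spi; apply: w_Snu.
have pS k : p ^+ k \in Su by apply: rpredX; apply: Snu_Su; apply: p_Snu.
(* [P] is an E-subspace containing [A], hence [B]. All precisions are required at once because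
   scaling by an element of E loses some. *)
pose P : set Ed := [set x | submodule_span B x /\
  forall c, exists l, exists2 y, B y & A (w ^+ l *: (x - p ^+ c *: y))].
have PE : is_submodule P.
  split.
    split; first by move=> Z [[]].
    by move=> c'; exists 0%N, 0; [exact: submod0 hB|rewrite scaler0 subr0 scaler0; exact: submod0 hA].
  move=> e x x' [Bx Px] [Bx' Px']; split.
    by move=> Z hZ; case: (hZ) => -[_ ZL] _; apply: ZL; [apply: Bx|apply: Bx'].
  (* Precision [c' + k1] is asked of [x] because bringing [e] into [Su] costs [p ^+ k1]. Similarly
     [e] is approximated to precision [c' + k2], where [p ^+ k2] brings [z] into [B]. *)
  move=> c'; have [k1 k1e] := exists_pX_Su e.
  have [l1 [y By Ay]] := Px (c' + k1)%N; have [l2 [y' By' Ay']] := Px' c'.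
  set z := x - p ^+ (c' + k1) *: y in Ay.
  have Bz : submodule_span B z.
    move=> Z hZ; case: (hZ) => -[_ ZL] BZ; rewrite /z addrC -scaleNr.
    by apply: ZL; [exact: BZ|exact: Bx].
  have [k2 k2z] := Espan_pX hB (@subset_refl _ B) Bz.
  have [l3 [e' [e'' [eE e'S e''S _]]]] := approx_wX e (c' + k2).
  exists (l1 + l2 + l3)%N, ((p ^+ k1 * e) *: y + e'' *: (p ^+ k2 *: z) + y').
    by apply: (submodD hB) => //; apply: (submodD hB); apply: (submodZ hB).
  have -> : w ^+ (l1 + l2 + l3) *:
      (e *: x + x' - p ^+ c' *: ((p ^+ k1 * e) *: y + e'' *: (p ^+ k2 *: z) + y')) =
      w ^+ l2 *: ((w ^+ l3 * e') *: (w ^+ l1 *: z)) +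
      w ^+ (l1 + l3) *: (w ^+ l2 *: (x' - p ^+ c' *: y')).
    by apply: density_identity => //; rewrite /z subrK.
  apply: (submodD hA); apply: wlA; last exact: Ay'.
  by apply: (submodZ hA).
have AP : A `<=` P.
  move=> x Ax; split; first exact: A_Espan.
  by move=> c'; exists 0%N, 0; [exact: submod0 hB|rewrite scaler0 subr0; apply: wlA].
move=> b Bb; have [_ /(_ c)[l [y By Ay]]] : P b by apply: (B_Espan Bb).
rewrite -[b](subrKC (p ^+ c *: y)); apply: (submodD hN); first exact: cE.
apply: (wVX_Su (k := l) hN); apply: sub_span; split=> //.
apply: (submodZ hB); first by apply: rpredX; apply: Snu_Su; apply: w_Snu.
by apply: (submodB hB) => //; apply: (submodZ hB).
Qed.

Let lift (a : E) (aS : a \in S) : subring_type S := Sub a aS.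

Let lift_inv (a : E) (aS : a \in S) :
  (forall f, f \in S -> exists2 r, r \in S & r * (1 - f * a) = 1) ->
  forall s : subring_type S, exists r, r * (1 - s * lift aS) = 1.
Proof.
move=> H s; have [r rS rE] := H (val s) (valP s).
by exists (lift rS); apply: val_inj.
Qed.

Lemma pair_maximal (hN : submod S (A `&` B)) : maximal_module (submodule_type hN).
Proof.
have tfN : torsion_free (submodule_type hN) by apply: submodule_torsion_free; apply: calE_inv.
have fgN : finitely_generated (submodule_type hN) by apply/submodule_fgP/pair_fg.
split=> //.
  split; first by apply: injective_kernel_finite_length.
  by apply: submodule_type_finite_length_coker => //; exact: flag_refl.
move=> N' f fgN' tfN' qf.
have p0 : lift (p_Snu D nu) != 0.
  apply/eqP => /(congr1 val)/= E0; have := pi_cstVr D nu.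
  by rewrite E0 mul0r => /eqP; rewrite eq_sym oner_eq0.
have w0 : lift (w_Snu D nu) != 0.
  apply/eqP => /(congr1 val)/= E0; have := w_monVr D nu.
  by rewrite E0 mul0r => /eqP; rewrite eq_sym oner_eq0.
have [f_inj pf] := quasi_isomorphism_nilpotent tfN qf p0 (lift_inv _ (@one_sub_mul_p_inv _ _ _ _ _)).
have [_ wf] := quasi_isomorphism_nilpotent tfN qf w0 (lift_inv _ (@one_sub_mul_w_inv _ _ _ _ _)).
apply: bijective_linear_inverse => // y.
have [k [x xE]] := pf y; have [l [x' x'E]] := wf y.
have xx' : w ^+ l *: (val x : Ed) = p ^+ k *: (val x' : Ed).
  have E0 := linear_preimage_comm f_inj xE x'E.
  have E1 := congr1 (fun z : submodule_type hN => (val z : Ed)) E0.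
  by rewrite !submodule_valZX in E1.
(* [z] equals both [x] divided by [p ^+ k] and [x'] divided by [w ^+ l]; the first form puts it in
   [A], the second in [B]. *)
pose z : Ed := pV ^+ k *: (val x : Ed).
have pz : p ^+ k *: z = val x by rewrite scalerA pX_pVX scale1r.
have zN : (A `&` B) z.
  have [Ax _] := submodule_memP x; have [_ Bx'] := submodule_memP x'.
  split; first by apply: (pVX_Spi (k := k) hA); rewrite pz.
  apply: (wVX_Su (k := l) hB); rewrite /z scalerA mulrC -scalerA xx' scalerA mulrC pX_pVX.
  by rewrite scale1r.
have zN' : (z : restrict_scalars S Ed) \in submodule_pred hN by apply/asboolP.
pose zz : submodule_type hN := Sub (z : restrict_scalars S Ed) zN'.
exists zz.
apply: (linear_preimage tfN' p0 xE); apply: val_inj.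
by rewrite -[RHS]pz; exact: submodule_valZX.
Qed.

End Pair.

(** * Recovering a maximal module from its two extensions *)

Lemma rows_submod (S' : subringClosed E) : submod S' (rows_in S' : set Ed).
Proof.
apply/submodP; split=> [j|a x y aS Sx Sy j]; rewrite !mxE; first exact: rpred0.
by apply: rpredD; [apply: rpredM|].
Qed.

Lemma Espan_span (S' : subringClosed E) M : submodule_span (span S' M) = submodule_span M.
Proof.
apply/seteqP; split=> x Mx Z [hZ MZ]; apply: Mx; split=> //.
  apply: span_min => //; case: hZ => Z0 ZL.
  by apply/submodP; split=> // a y z _; apply: ZL.
by move=> y My; apply: MZ; apply: sub_span.
Qed.

(** By density, [w ^+ l *: x] is an element of [M] up to [p ^+ c *: y]. Once [y] is known to lie in
    both spans, the bound [c] puts this error in [M] too. *)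
Lemma span_Su_wX M c : submod S M ->
  (forall x, (span Spi M `&` span Su M) x -> M (p ^+ c *: x)) ->
  forall x, (span Spi M `&` span Su M) x -> exists l, M (w ^+ l *: x).
Proof.
move=> hM pM; have hA := span_submod Spi M; have hB := span_submod Su M.
have wS l : w ^+ l \in S by apply: rpredX; apply: w_Snu.
have wSu l : w ^+ l \in Su by apply: Snu_Su.
have MB := @sub_span _ Su _ M.
pose P : set Ed := [set x | exists l m y, [/\ M m, span Su M y & w ^+ l *: x = m + p ^+ c *: y]].
have PS : submod Su P.
  apply/submodP; split.
    exists 0%N, 0, 0; split; [exact: submod0 hM|exact: submod0 hB|by rewrite !scaler0 addr0].
  move=> a x x' aS [l1 [m [y [Mm By xE]]]] [l2 [m' [y' [Mm' By' xE']]]].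
  have [l3 [a' [a'' [aE _ aS'' aS']]]] := approx_wX a c.
  exists (l1 + l2 + l3)%N, (w ^+ l2 *: ((w ^+ l3 * a') *: m) + w ^+ (l1 + l3) *: m').
  exists ((w ^+ (l2 + l3) * a'') *: m + (w ^+ (l2 + l3) * a) *: y + w ^+ (l1 + l3) *: y').
  split; last exact: numerator_identity.
    apply: (submodD hM); apply: (submodZ hM) => //.
    by apply: (submodZ hM) => //; apply: aS'.
  have MBm : span Su M m by apply: MB.
  apply: (submodD hB); last by apply: (submodZ hB).
  by apply: (submodD hB); apply: (submodZ hB) => //; apply: rpredM.
move=> x [Ax Bx]; have [l [m [y [Mm By xE]]]] : P x.
  apply: (span_min PS _ Bx) => m Mm; exists 0%N, m, 0.
  by split=> //; [exact: submod0 hB|rewrite expr0 scale1r scaler0 addr0].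
(* [p ^+ c *: y] is a difference of elements of the [Spi]-span, where [p] is invertible. *)
exists l; rewrite xE; apply: (submodD hM) => //; apply: pM; split=> //.
apply: (pVX_Spi (k := c) hA); rewrite -[_ *: y](addKr m) -xE addrC.
apply: (submodB hA); last exact: sub_span.
by apply: (submodZ hA) => //; apply: Snu_Spi.
Qed.

Lemma maximal_eq_inter M (hM : submod S M) : M `<=` rows_in S ->
  maximal_module (submodule_type hM) -> M = span Spi M `&` span Su M.
Proof.
move=> MS [_ _ _ Mmax].
have hA := span_submod Spi M; have hB := span_submod Su M.
have AS : span Spi M `<=` rows_in Spi.
  by apply: span_min (rows_submod _) _ => x /MS Mx j; apply: Snu_Spi.
have BS : span Su M `<=` rows_in Su.
  by apply: span_min (rows_submod _) _ => x /MS Mx j; apply: Snu_Su.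
have MN : M `<=` span Spi M `&` span Su M by move=> x Mx; split; apply: sub_span.
have hN := pair_submod hA hB.
have [n [g gN]] := pair_fg hA hB AS BS; have [gN1 gE] := gN.
have [k kE] := choice (fun i => span_Spi_pX hM (gN1 i).1).
pose c := \max_i k i.
have pM x : (span Spi M `&` span Su M) x -> M (p ^+ c *: x).
  move=> /gE[a [aS ->]]; rewrite scaler_sumr; apply: (submod_sum hM) => i.
  rewrite scalerA mulrC -scalerA; apply: (submodZ hM) => //.
  by apply: submod_pX (kE i) => //; apply: leq_bigmax.
have flagMN : flag S M (span Spi M `&` span Su M).
  apply: (flag_generators hM gN) => i; first by exists (k i).
  exact: (span_Su_wX hM pM (gN1 i)).
(* Maximality applied to the inclusion [f] gives a retraction [h] onto [M]. *)
pose f : {linear submodule_type hM -> submodule_type hN} := submodule_incl (hM := hM) hN MN.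
have [|||h hE] := Mmax (submodule_type hN) f.
- by apply/submodule_fgP; exists n, g.
- by apply: submodule_torsion_free; apply: calE_inv.
- split; last exact: submodule_type_finite_length_coker.
  apply: injective_kernel_finite_length => x fx; apply: val_inj.
  exact: (congr1 val fx).
apply/seteqP; split=> // x Nx.
have xN : (x : restrict_scalars S Ed) \in submodule_pred hN by apply/asboolP.
have pxM : (p ^+ c *: x : restrict_scalars S Ed) \in submodule_pred hM.
  by apply/asboolP; apply: pM.
pose z : submodule_type hN := Sub (x : restrict_scalars S Ed) xN.
pose m : submodule_type hM := Sub (p ^+ c *: x : restrict_scalars S Ed) pxM.
pose ps : subring_type S := Sub p (p_Snu D nu).
have fm : f m = ps ^+ c *: z by apply: val_inj; apply/esym; exact: submodule_valZX.
(* The retraction fixes [p ^+ c *: x], which lies in [M]; cancelling the power of [p] shows that it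
   fixes [x]. *)
have hz : ps ^+ c *: h z = m by rewrite -linearZ -fm hE.
have hzx : p ^+ c *: (val (h z) - x : Ed) = 0.
  have := congr1 (fun t : submodule_type hM => (val t : Ed)) hz.
  by rewrite submodule_valZX scalerBr => ->; rewrite subrr.
have <- : (val (h z) : Ed) = x by apply/subr0_eq/pX_cancel/hzx.
exact: submodule_memP.
Qed.

(** * The correspondence between maximal modules and pairs *)

Lemma submod_Free_Spi A : submod Spi A -> A `<=` rows_in Spi -> Free Spi A.
Proof.
move=> hA AS; split=> //.
by apply: submod_free => //; [exact: calE_inv|exact: Spi_principal].
Qed.

Lemma submod_Free_Su B : submod Su B -> B `<=` rows_in Su -> Free Su B.
Proof.
move=> hB BS; split=> //.
by apply: submod_free => //; [exact: calE_inv|exact: Su_principal].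
Qed.

(** This gives injectivity: a maximal module is determined by its image under [Psi]. *)
Lemma Max_inter M : Max D nu d M -> M = (Psi D nu d M).1 `&` (Psi D nu d M).2.
Proof. by move=> [MS [hM Mmax]]; apply: (@maximal_eq_inter M hM). Qed.

Lemma Psi_Free M : Max D nu d M ->
  [/\ Free Spi (Psi D nu d M).1, Free Su (Psi D nu d M).2 &
    submodule_span (Psi D nu d M).1 = submodule_span (Psi D nu d M).2].
Proof.
move=> [MS _]; split; last by rewrite [LHS]Espan_span [RHS]Espan_span.
  apply: submod_Free_Spi; first exact: span_submod.
  by apply: span_min (rows_submod _) _ => x /MS Mx j; apply: Snu_Spi.
apply: submod_Free_Su; first exact: span_submod.
by apply: span_min (rows_submod _) _ => x /MS Mx j; apply: Snu_Su.
Qed.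

Lemma Max_pair A B : Free Spi A -> Free Su B -> submodule_span A = submodule_span B ->
  Max D nu d (A `&` B) /\ Psi D nu d (A `&` B) = (A, B).
Proof.
move=> [hA AS _] [hB BS _] AB; split.
  split; first exact: pair_rows.
  by exists (pair_submod hA hB); apply: pair_maximal.
by congr pair; [apply: pair_span_Spi|apply: pair_span_Su].
Qed.

End Lattices.

Theorem theorem1p1 (R : idomainType) (pi : R) (v : {fraction R} -> int)
    (D : complete_dvr pi v) (nu : rat) (d : nat) (d_gt0 : (0 < d)%N) :
  [/\ set_fun (Max D nu d) (Free (Spi D nu) `*` Free (Su D nu)) (Psi D nu d),
      set_inj (Max D nu d) (Psi D nu d),
      (Psi D nu d) @` Max D nu d =
        [set AB : set 'rV[calE D nu]_d * set 'rV[calE D nu]_d | [/\ Free (Spi D nu) AB.1, Free (Su D nu) AB.2 & submodule_span AB.1 = submodule_span AB.2]] &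
      forall A B : set 'rV[calE D nu]_d,
        Free (Spi D nu) A -> Free (Su D nu) B -> submodule_span A = submodule_span B ->
        Max D nu d `&` Psi D nu d @^-1` [set (A, B)] = [set A `&` B]].
Proof.
split.
- by move=> M /Psi_Free[FA FB _].
- move=> M N /set_mem/Max_inter ME /set_mem/Max_inter NE MN.
  by rewrite ME NE MN.
- apply/seteqP; split=> [_ [M /Psi_Free MM <-] //|[A B] [/= FA FB AB]].
  by have [NM NE] := Max_pair FA FB AB; exists (A `&` B).
move=> A B FA FB AB; have [NM NE] := Max_pair FA FB AB.
apply/seteqP; split=> [M [/Max_inter ME /= MAB]|_ -> //].
by rewrite /= ME MAB.
Qed.
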